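(* Let $\Sigma\subset\mathbb R^2$ be a damping set, $S:\mathbb R\rightrightarrows\mathbb R$ the set-valued map whose graph is $R\Sigma$, $p\in[1,+\infty]$, and assume that $S^{[2]}$ is closed (i.e. has closed graph). Then the wave equation associated with $\Sigma$ is strongly stable in $\mathsf X_p$ if and only if $S^{[2]}$ is a strict damping.
   Context: Notation: $\mathbb R_+=[0,+\infty)$, $R=\begin{pmatrix}\frac1{\sqrt2}&\frac1{\sqrt2}\\-\frac1{\sqrt2}&\frac1{\sqrt2}\end{pmatrix}$ and $R\Sigma=\{R\xi:\xi\in\Sigma\}$. The graph of $S:\mathbb R\rightrightarrows\mathbb R$ is $\{(x,y):y\in S(x)\}$. $S^{[2]}=S\circ S$, i.e. $z\in S^{[2]}(x)$ iff there is $y\in S(x)$ with $z\in S(y)$. $L^p_{\mathrm{loc}}(a,+\infty)$ is the set of measurable functions whose restriction to $(a,T)$ is in $L^p$ for every $T>a$. $W^{1,p}_*(0,1)=\{u\in L^p(0,1): u'\in L^p(0,1),\ u(0)=0\}$ and $\mathsf X_p=W^{1,p}_*(0,1)\times L^p(0,1)$, with norm $\|(u,v)\|_{\mathsf X_p}^p=2^{-p/2}\int_0^1(|u'+v|^p+|u'-v|^p)\,dx$ if $p<+\infty$ and $\|(u,v)\|_{\mathsf X_\infty}=\frac1{\sqrt2}\max(\|u'+v\|_{L^\infty(0,1)},\|u'-v\|_{L^\infty(0,1)})$. The wave equation associated with $\Sigma$ is: $z_{tt}=z_{xx}$ on $\mathbb R_+\times[0,1]$; $z(t,0)=0$ and $(z_t(t,1),-z_x(t,1))\in\Sigma$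 for $t\in\mathbb R_+$; $z(0,x)=z_0(x)$, $z_t(0,x)=z_1(x)$ for $x\in[0,1]$. A (weak, global in time) solution in $\mathsf X_p$ with initial condition $(z_0,z_1)\in\mathsf X_p$ is a function $z:\mathbb R_+\times[0,1]\to\mathbb R$ for which there exist $f\in L^p_{\mathrm{loc}}(0,+\infty)$ and $g\in L^p_{\mathrm{loc}}(-1,+\infty)$ such that $z(t,x)=\frac1{\sqrt2}\int_0^{t+x}f+\frac1{\sqrt2}\int_0^{t-x}g$ for all $(t,x)\in\mathbb R_+\times[0,1]$, $z(t,0)=0$ and $(z_t(t,1),-z_x(t,1))\in\Sigma$ for a.e. $t\in\mathbb R_+$, and $z(0,x)=z_0(x)$, $z_t(0,x)=z_1(x)$ for a.e. $x\in[0,1]$; here $z_t(t,x)=\frac{f(t+x)+g(t-x)}{\sqrt2}$ and $z_x(t,x)=\frac{f(t+x)-g(t-x)}{\sqrt2}$. Set $e_p(z)(t)=\|(z(t,\cdot),z_t(t,\cdot))\|_{\mathsf X_p}$. Damping: a set $\Sigma$ is a damping set if $(0,0)\in\Sigma$, $xy\ge0$ for every $(x,y)\in\Sigma$, and $R\Sigma$ contains the graph of a universally measurable function $\varphi:\mathbb R\to\mathbb R$ with linear growth ($|\varphi(x)|\le a|x|+b$ for some $a,b\ge0$). It is strict if moreover $xy>0$ for every $(x,y)\in\Sigma\setminus\{(0,0)\}$. A set-valued map $T:\mathbb R\rightrightarrows\mathbb R$ is called a (strict) damping if its graph equals $R\Sigma'$ for a (strict) damping set $\Sigma'$; equivalently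 $0\in T(0)$, the graph of $T$ contains the graph of a universally measurable function with linear growth, and $|y|\le|x|$ (for strict: $|y|<|x|$ whenever $(x,y)\ne(0,0)$) for all $x\in\mathbb R$, $y\in T(x)$. A set $M\subset\mathbb R$ is universally measurable if for every Borel probability measure $\nu$ on $\mathbb R$ there exist Borel sets $A\subset M\subset B$ with $\nu(B\setminus A)=0$; $\varphi$ is universally measurable if preimages of Borel sets are universally measurable. (For a damping set, solutions exist for every initial condition in $\mathsf X_p$.) The wave equation is strongly stable in $\mathsf X_p$ if every solution $z$ in $\mathsf X_p$ (for every initial condition in $\mathsf X_p$) satisfies $\lim_{t\to+\infty}e_p(z)(t)=0$. *)

(* Defs.v *)
From HB Require Import structures.
From mathcomp Require Import all_boot all_order all_algebra.
From mathcomp Require Import all_classical all_reals all_analysis.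

Set Implicit Arguments.
Unset Strict Implicit.
Unset Printing Implicit Defensive.

Import Order.TTheory GRing.Theory Num.Theory.
Import numFieldNormedType.Exports.

Local Open Scope classical_set_scope.
Local Open Scope ring_scope.

Section Defs.
Context {R : realType}.
Notation mu := (@lebesgue_measure R).

Implicit Types (p : \bar R) (D : set R) (f g u v w phi : R -> R).

(** * Set-valued maps and damping sets *)

(* xi |-> R xi for R = ((1/sqrt 2, 1/sqrt 2), (-1/sqrt 2, 1/sqrt 2)) *)
Definition rotR (xi : R * R) : R * R :=
  ((xi.1 + xi.2) / Num.sqrt 2, (- xi.1 + xi.2) / Num.sqrt 2).

Definition svgraph (S : R -> set R) : set (R * R) := [set xy | S xy.1 xy.2].

Definition svcomp (T S : R -> set R) : R -> set R :=
  fun x => [set z | exists2 y, S x y & T y z].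

Definition univ_measurable_set (M : set R) : Prop :=
  forall nu : probability (measurableTypeR R) R,
  exists A B : set (measurableTypeR R),
    [/\ measurable A, measurable B, A `<=` M, M `<=` B & nu (B `\` A) = 0%E].

Definition univ_measurable_fun (phi : R -> R) : Prop :=
  forall B : set (measurableTypeR R),
    measurable B -> univ_measurable_set (phi @^-1` B).

Definition linear_growth (phi : R -> R) : Prop :=
  exists a b : R, [/\ 0 <= a, 0 <= b & forall x, `|phi x| <= a * `|x| + b].

Definition damping_set (Sigma : set (R * R)) : Prop :=
  [/\ Sigma (0, 0),
      forall x y, Sigma (x, y) -> 0 <= x * y &
      exists phi : R -> R, [/\ univ_measurable_fun phi, linear_growth phi &
        forall x, (rotR @` Sigma) (x, phi x)]].

Definition strict_damping_set (Sigma : set (R * R)) : Prop :=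
  damping_set Sigma /\
  forall x y, Sigma (x, y) -> (x, y) <> (0, 0) -> 0 < x * y.

Definition strict_damping (T : R -> set R) : Prop :=
  exists Sigma, strict_damping_set Sigma /\ svgraph T = rotR @` Sigma.

(** * Function spaces *)

(* Elements of L^p are functions, not classes. [measurable_fun] refers to the
   Borel sigma-algebra; every Lebesgue class has a Borel representative. *)
Definition Lp p D f : Prop :=
  measurable_fun D f /\ finite_norm mu p (f \_ D).

Definition Lploc p (a : R) f : Prop :=
  measurable_fun `]a, +oo[ f /\ forall T, a < T -> Lp p `]a, T[ f.

(* C^1 functions with compact support in (0, 1) *)
Definition test_function phi : Prop :=
  [/\ forall x, derivable phi x 1,
      continuous (derive1 phi) &
      exists a b : R, [/\ 0 < a, b < 1 &
        forall x, x \notin `[a, b] -> phi x = 0]].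

Definition weak_derivative u w : Prop :=
  [/\ locally_integrable (`]0, 1[ : set R) u,
      locally_integrable (`]0, 1[ : set R) w &
      forall phi, test_function phi ->
        \int[mu]_(x in `]0, 1[) (u x * derive1 phi x) =
        - \int[mu]_(x in `]0, 1[) (w x * phi x)].

(* A weak derivative of u; it is unique up to a null set, and the value is
   irrelevant when u has no weak derivative. *)
Definition wderiv u : R -> R := xget (cst 0) [set w | weak_derivative u w].

(* u(0) = 0 is understood for the continuous representative of u. *)
Definition W1p_star p u : Prop :=
  [/\ Lp p `]0, 1[ u,
      (exists2 w, weak_derivative u w & Lp p `]0, 1[ w) &
      exists ut : R -> R,
        [/\ {within `[0, 1], continuous ut},
            {ae mu, forall x, x \in `]0, 1[ -> u x = ut x} & ut 0 = 0]].

Definition Xp p u v : Prop := W1p_star p u /\ Lp p `]0, 1[ v.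

Definition Xnorm p u v : \bar R :=
  let a x := wderiv u x + v x in
  let b x := wderiv u x - v x in
  match p with
  | r%:E =>
      (((2 `^ (- (r / 2)))%:E *
        \int[mu]_(x in `]0%R, 1%R[) (`|a x| `^ r + `|b x| `^ r)%:E) `^ r^-1)%E
  | +oo%E =>
      (((Num.sqrt 2)^-1)%:E *
       maxe 'N[mu]_+oo%E [EFin \o (a \_ `]0%R, 1%R[)]
            'N[mu]_+oo%E [EFin \o (b \_ `]0%R, 1%R[)])%E
  | -oo%E => 0%E (* unused: p >= 1 *)
  end.

(** * The wave equation *)

(* Oriented integral of f from a to b, whatever the order of a and b *)
Definition oint (a b : R) f : R :=
  if a <= b then \int[mu]_(s in `[a, b]) f s
  else - \int[mu]_(s in `[b, a]) f s.

Definition wave_t f g (t x : R) : R := (f (t + x) + g (t - x)) / Num.sqrt 2.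

Definition wave_x f g (t x : R) : R := (f (t + x) - g (t - x)) / Num.sqrt 2.

(* z is a weak, global in time solution in X_p with initial condition (z0, z1),
   as witnessed by the travelling waves f and g. The values of z outside
   R_+ x [0, 1] play no role. *)
Definition wave_solution_with p (Sigma : set (R * R)) (z0 z1 : R -> R)
    (z : R -> R -> R) f g : Prop :=
  [/\ Lploc p 0 f, Lploc p (-1) g,
      forall t x, 0 <= t -> 0 <= x <= 1 ->
        z t x = (Num.sqrt 2)^-1 * oint 0 (t + x) f
              + (Num.sqrt 2)^-1 * oint 0 (t - x) g,
      {ae mu, forall t, 0 <= t ->
        z t 0 = 0 /\ Sigma (wave_t f g t 1, - wave_x f g t 1)} &
      {ae mu, forall x, 0 <= x <= 1 -> z 0 x = z0 x /\ wave_t f g 0 x = z1 x}].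

(* e_p(z)(t). Since f and g are determined by z up to null sets, so is z_t(t, .),
   hence the value depends on z only. *)
Definition energy p (z : R -> R -> R) f g (t : R) : \bar R :=
  Xnorm p (z t) (wave_t f g t).

Definition strongly_stable p (Sigma : set (R * R)) : Prop :=
  forall z0 z1, Xp p z0 z1 ->
  forall z f g, wave_solution_with p Sigma z0 z1 z f g ->
    energy p z f g t @[t --> +oo] --> 0%E.

End Defs.

(* Main.v *)
Require Import Defs.
From HB Require Import structures.
From mathcomp Require Import all_boot all_order all_algebra.
From mathcomp Require Import all_classical all_reals all_analysis.
From mathcomp Require Import measurable_realfun ess_sup_inf ring lra.
Import Order.TTheory GRing.Theory Num.Theory.
Import numFieldNormedType.Exports.

Set Implicit Arguments.
Unset Strict Implicit.
Unset Printing Implicit Defensive.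

Local Open Scope classical_set_scope.
Local Open Scope ring_scope.

(** A solution is a superposition of two travelling waves f (t + x) and
    g (t - x).  The condition at x = 0 forces f = - g on the positive half-line
    ([solution_antisym]), and the rotation R sends the pair of boundary traces
    at x = 1 to (g (t - 1), g (t + 1)).  So for almost every s >= -1 the sequence
    g (s + 2 n) is an orbit of S ([solution_orbit]), and the energy at time t is
    the L^p norm of g over the window (t - 1, t + 1) ([energy_fin],
    [energy_oo_le]): stability of the wave equation is a statement about orbits
    of S.

    If S^[2] is a strict damping, every orbit tends to 0.  The closedness of
    S^[2] makes this uniform over bounded initial values: on the compact part
    e <= |x| <= M of the graph, |x| - |y| has a positive minimum, hence an orbit
    starting in [-M, M] enters [-e, e] within a number of steps that depends on
    M and e only ([orbit_decay]).  For p = +oo the data g on (-1, 3) are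
    essentially bounded, and this is the decay of the energy.  For p < +oo the
    functions |g (s + 2 n)|^p on (-1, 3) are dominated by |g|^p, because |g|
    decreases along orbits, and tend to 0 pointwise, so that dominated
    convergence applies ([block_integral_cvg0]).

    If S^[2] is not strict, it has a point (x, z) <> (0, 0) with |z| = |x|.  The
    intermediate value has the same modulus, so all three values are x or - x
    and S contains a cycle a, b, a with |a| = |b| <> 0, possibly with a = b
    ([isometric_cycle]).  Running through this cycle gives a solution whose g is
    a square wave of constant modulus, hence of energy bounded below
    ([square_not_stable]).  The remaining part of being a damping passes from S
    to S^[2] since universally measurable functions of linear growth are stable
    under composition: such a function agrees almost everywhere, for a given
    probability, with a Borel one ([univ_measurable_ae_borel]).

    The energy is defined through an arbitrary weak derivative of the position,
    so it has to be related to f and g by two facts on ]0, 1[.  A primitive of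
    an integrable function has that function as weak derivative
    ([weak_derivative_primitive], Fubini on a triangle), and weak derivatives
    are unique almost everywhere ([weak_derivative_unique]): C^1 plateaus
    increasing to the indicator of an interval show that the difference of two
    of them has integral 0 over every interval, and the Lebesgue differentiation
    theorem concludes. *)

(** * Rotated coordinates and orbits *)

Section Damping.
Context {R : realType}.
Implicit Types (Sigma : set (R * R)) (S T : R -> set R) (xi : R * R).

Lemma sqrt2_neq0 : Num.sqrt (2 : R) != 0.
Proof. by rewrite gt_eqF// sqrtr_gt0. Qed.

Lemma divr_sqrt2 (x : R) : x / Num.sqrt 2 / Num.sqrt 2 = x / 2.
Proof. by rewrite -mulrA -invfM -expr2 sqr_sqrtr. Qed.

Lemma rotR_inj : injective (@rotR R).
Proof.
move=> [x y] [x' y'] [] /(mulIf (invr_neq0 sqrt2_neq0)) e1.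
move=> /(mulIf (invr_neq0 sqrt2_neq0)) e2.
by congr (_, _); lra.
Qed.

(** R diagonalises the quadratic form x y: this is what turns the sign
    condition on a damping set into a contraction property of its rotated graph. *)
Lemma rotR_sqrB xi : (rotR xi).1 ^+ 2 - (rotR xi).2 ^+ 2 = 2 * (xi.1 * xi.2).
Proof.
by rewrite /rotR/= !expr_div_n sqr_sqrtr//; field.
Qed.

Lemma rotR_surj (ab : R * R) : exists xi, rotR xi = ab.
Proof.
exists ((ab.1 - ab.2) / Num.sqrt 2, (ab.1 + ab.2) / Num.sqrt 2).
rewrite [RHS]surjective_pairing /rotR/=; congr (_, _).
  by rewrite -mulrDl divr_sqrt2; field.
by rewrite -mulNr -mulrDl divr_sqrt2; field.
Qed.

(** With a and b the values of the two waves at the right endpoint, the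
    rotated boundary condition says that S maps b to - a. *)
Lemma rotR_traces (a b : R) :
  rotR ((a + b) / Num.sqrt 2, - ((a - b) / Num.sqrt 2)) = (b, - a).
Proof.
rewrite /rotR/= -!mulNr -!mulrDl !divr_sqrt2; congr (_, _); by field.
Qed.

Lemma damping_le Sigma S : damping_set Sigma -> svgraph S = rotR @` Sigma ->
  forall x y, S x y -> `|y| <= `|x|.
Proof.
move=> [_ Sge0 _] gS x y Sxy.
have : svgraph S (x, y) by [].
rewrite gS => -[[a b] /Sge0 ab0 rab].
rewrite -ler_sqr ?nnegrE// !real_normK ?num_real// -subr_ge0.
by have := rotR_sqrB (a, b); rewrite rab/= => ->; rewrite mulr_ge0.
Qed.

Lemma damping00 Sigma S : damping_set Sigma -> svgraph S = rotR @` Sigma ->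
  S 0 0.
Proof.
move=> [S0 _ _] gS.
suff : svgraph S (0, 0) by [].
by rewrite gS; exists (0, 0) => //; rewrite /rotR/= oppr0 addr0 mul0r.
Qed.

(** Strict damping in terms of the set-valued map alone, so that rotated sets
    need not be handled afterwards. *)
Lemma strict_dampingP T : strict_damping T <->
  [/\ T 0 0,
      exists phi, [/\ univ_measurable_fun phi, linear_growth phi &
        forall x, T x (phi x)] &
      forall x y, T x y -> (x, y) <> (0, 0) -> `|y| < `|x|].
Proof.
have lt_sqr (x y : R) : (`|y| < `|x|) = (0 < x ^+ 2 - y ^+ 2).
  by rewrite -ltr_sqr ?nnegrE// !real_normK ?num_real// subr_gt0.
split=> [[Sigma [[dS sS] gT]]|[T0 [phi [um lg Tphi]] sT]].
- split; first exact: damping00 gT.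
    case: dS => _ _ [phi [um lg Sphi]]; exists phi; split => // x.
    by suff : svgraph T (x, phi x) by []; rewrite gT.
  move=> x y Txy xy0; have : svgraph T (x, y) by [].
  rewrite gT => -[[a b] Sab rab]; rewrite lt_sqr.
  have := rotR_sqrB (a, b); rewrite rab/= => ->; rewrite mulr_gt0// sS// => ab0.
  by apply: xy0; rewrite -rab ab0 /rotR/= oppr0 addr0 mul0r.
- have gT : svgraph T = rotR @` [set xi | svgraph T (rotR xi)].
    apply/seteqP; split => [ab Tab|_ [xi Txi <-]//].
    by have [xi xiab] := rotR_surj ab; exists xi; rewrite //= xiab.
  have pos x y : svgraph T (rotR (x, y)) -> (x, y) <> (0, 0) -> 0 < x * y.
    move=> Txy xy0; rewrite -(pmulr_rgt0 _ (ltr0n _ 2)) -(rotR_sqrB (x, y)).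
    rewrite -lt_sqr; apply: sT => // e0; apply: xy0; apply: rotR_inj.
    by rewrite [LHS]surjective_pairing e0 /rotR/= oppr0 addr0 mul0r.
  exists [set xi | svgraph T (rotR xi)]; split => //; split=> //.
  split.
  + by rewrite /= /svgraph /rotR/= oppr0 addr0 mul0r.
  + move=> x y Txy; have [[-> ->]|xy0] := pselect ((x, y) = (0, 0)).
      by rewrite mulr0.
    exact/ltW/pos.
  + by exists phi; split => // x; rewrite -gT; exact: Tphi.
Qed.

Lemma svcomp_orbit S (u : nat -> R) : (forall n, S (u n) (u n.+1)) ->
  forall n, svcomp S S (u n) (u n.+2).
Proof. by move=> Su n; exists (u n.+1). Qed.

Lemma orbit_nonincreasing S (u : nat -> R) :
  (forall x y, S x y -> `|y| <= `|x|) -> (forall n, S (u n) (u n.+1)) ->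
  {homo (fun n => `|u n|) : m n / (m <= n)%N >-> n <= m}.
Proof.
move=> leS Su; apply: (homo_leq (r := fun x y => y <= x)) => //.
- by move=> a b c ba cb; exact: le_trans cb ba.
- by move=> n; exact: leS.
Qed.

(** The contraction |y| < |x| has a uniform gap on e <= |x| <= M since the
    graph is compact there. *)
Lemma closed_strict_gap T (M e : R) : closed (svgraph T) ->
  (forall x y, T x y -> (x, y) <> (0, 0) -> `|y| < `|x|) -> 0 < e ->
  exists2 d, 0 < d & forall x y, T x y -> e <= `|x| <= M -> `|y| <= `|x| - d.
Proof.
move=> clT sT e0.
pose K := svgraph T `&` [set xy : R * R | e <= `|xy.1|] `&`
  (`[- M, M] `*` `[- M, M]).
have cK : compact K.
  rewrite /K setIC; apply: compact_closedI.
    by apply: compact_setX; exact: segment_compact.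
  apply: closedI => //.
  have -> : [set xy : R * R | e <= `|xy.1|] =
      (fun xy : R * R => `|xy.1|) @^-1` [set y | e <= y] by [].
  apply: closed_comp; last exact: closed_ge.
  by move=> xy _; apply: continuous_comp; [exact: cvg_fst|exact: norm_continuous].
pose F (xy : R * R) := `|xy.1| - `|xy.2|.
have cF : continuous F.
  move=> xy; apply: cvgB.
    by apply: continuous_comp; [exact: cvg_fst|exact: norm_continuous].
  by apply: continuous_comp; [exact: cvg_snd|exact: norm_continuous].
have inK x y : T x y -> e <= `|x| <= M -> K (x, y).
  move=> Txy /andP[ex xM].
  have xy0 : (x, y) <> (0, 0).
    by case=> x0 _; move: ex; rewrite x0 normr0 leNgt e0.
  have yM : `|y| <= M by rewrite (le_trans _ xM)// ltW// sT.
  by split => //=; rewrite !in_itv/= -!ler_norml.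
have [K0|/set0P[xy0 Kxy0]] := eqVneq K set0.
  by exists 1 => // x y Txy /inK-/(_ _ Txy); rewrite K0.
have [c cK' minF] := compact_EVT_min (ex_intro _ _ Kxy0) cK (continuous_subspaceT cF).
exists (F c) => [|x y Txy exM].
  have [[Tc ec] _] : K c by exact: set_mem.
  rewrite subr_gt0; apply: sT Tc _; case: c {cK' minF} ec => c1 c2 /= ec [c10 _].
  by move: ec; rewrite c10 normr0 leNgt e0.
by have := minF (x, y) (mem_set (inK _ _ Txy exM)); rewrite /F/=; lra.
Qed.

(** Outside [-e, e] each double step decreases the modulus by at least the gap
    d, so an orbit starting in [-M, M] has entered [-e, e] after K double steps
    as soon as K d > M, and the modulus never increases afterwards. *)
Lemma orbit_decay S (M e : R) : closed (svgraph (svcomp S S)) ->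
  (forall x y, S x y -> `|y| <= `|x|) ->
  (forall x z, svcomp S S x z -> (x, z) <> (0, 0) -> `|z| < `|x|) ->
  0 < e ->
  exists N, forall u : nat -> R, (forall n, S (u n) (u n.+1)) ->
    `|u 0| <= M -> forall n, (N <= n)%N -> `|u n| <= e.
Proof.
move=> clS leS ltSS e0.
have [d d0 gap] := closed_strict_gap M clS ltSS e0.
pose K := Num.Def.archi_bound `|M / d|.
exists K.*2 => u Su uM n Kn.
have decr := orbit_nonincreasing leS Su.
(* An orbit that has not entered [-e, e] has lost at least d at each double step. *)
have dec k : `|u k.*2| <= e \/ `|u k.*2| <= M - k%:R * d.
  elim: k => [|k [IH|IH]]; first by rewrite mul0r subr0; right.
    by left; rewrite (le_trans _ IH)// decr// leq_double.
  have [ue|eu] := leP `|u k.*2| e.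
    by left; rewrite (le_trans _ ue)// decr// leq_double.
  right; have := gap _ _ (svcomp_orbit Su k.*2).
  rewrite (ltW eu) (le_trans (decr 0 k.*2 _))//= => /(_ isT).
  by rewrite doubleS -natr1 mulrDl mul1r; lra.
rewrite (le_trans (decr _ _ Kn))//; case: (dec K) => // uK.
rewrite (le_trans uK)// (le_trans _ (ltW e0))// subr_le0 -ler_pdivrMr//.
by rewrite (le_trans (ler_norm _))// ltW// archi_boundP.
Qed.

End Damping.

(** * Universally measurable functions *)

Section UniversallyMeasurable.
Context {R : realType}.

Let q_ (n : nat) : R := ratr (odflt 0 (unpickle n)).

Let q_dense (x y : R) : x < y -> exists n, x < q_ n < y.
Proof.
move=> /rat_in_itvoo[q]; rewrite in_itv/= => xqy.
by exists (pickle q); rewrite /q_ pickleK.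
Qed.

(** For each q in a countable dense set, the preimage of ]q, +oo[ is squeezed
    between Borel sets that differ by a null set.  Off the union N of these null
    sets phi is Borel, so psi is phi off N and 0 on N. *)
Lemma univ_measurable_ae_borel (phi : R -> R)
    (nu : probability (measurableTypeR R) R) : univ_measurable_fun phi ->
  exists psi : {mfun measurableTypeR R >-> measurableTypeR R},
  exists N : set (measurableTypeR R),
    [/\ measurable N, nu N = 0%E & forall x, ~ N x -> phi x = psi x].
Proof.
move=> mphi.
have /choice[AB ABP] : forall n, exists AB : set (measurableTypeR R) * set (measurableTypeR R),
    [/\ measurable AB.1, measurable AB.2,
      AB.1 `<=` phi @^-1` `]q_ n, +oo[,
      phi @^-1` `]q_ n, +oo[ `<=` AB.2 & nu (AB.2 `\` AB.1) = 0%E].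
  move=> n; have [A [B ?]] := mphi `]q_ n, +oo[%classic (measurable_itv _) nu.
  by exists (A, B).
pose N := \bigcup_n ((AB n).2 `\` (AB n).1).
have mN : measurable N.
  by apply: bigcup_measurable => n _; case: (ABP n) => *; exact: measurableD.
have nuN : nu N = 0%E.
  apply/negligibleP => //; apply: negligible_bigcup => n.
  by case: (ABP n) => *; apply/negligibleP => //; exact: measurableD.
pose psi : measurableTypeR R -> measurableTypeR R := phi \_ (~` N).
have psiN x : ~ N x -> psi x = phi x by move=> Nx; rewrite /psi patchE mem_set.
have psi0 x : N x -> psi x = 0.
  by move=> Nx; rewrite /psi patchE memNset// => /(_ Nx).
(* On N the value of psi is 0, hence the case distinction on the sign of q_ n. *)
have mq n : measurable (psi @^-1` `]q_ n, +oo[).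
  have -> : psi @^-1` `]q_ n, +oo[ =
      ((AB n).1 `\` N) `|` (if q_ n < 0 then N else set0).
    case: (ABP n) => _ _ lo hi _.
    apply/seteqP; split=> x /=; rewrite in_itv/= andbT.
      have [Nx|Nx] := pselect (N x); first by rewrite psi0// => ->; right.
      rewrite psiN// => qx; left; split => //; apply: contrapT => Ax.
      by apply: Nx; exists n => //; split => //; apply: hi; rewrite /= in_itv/= qx.
    move=> [[/lo/= + Nx]|]; first by rewrite in_itv/= andbT psiN.
    by case: ifPn => // q0 Nx; rewrite psi0.
  apply: measurableU; last by case: ifPn.
  by case: (ABP n) => *; exact: measurableD.
have mpsi : measurable_fun setT psi.
  move=> mT; apply: (measurability _ (RGenOInfty.measurableE R)) => //.
  move=> /= _ [_ [a ->] <-]; rewrite setTI.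
  have -> : psi @^-1` `]a, +oo[ =
      \bigcup_(n in [set n | a < q_ n]) (psi @^-1` `]q_ n, +oo[).
    apply/seteqP; split=> x /=.
      rewrite in_itv/= andbT => /q_dense[n /andP[aq qx]].
      by exists n => //=; rewrite in_itv/= qx.
    move=> [n /= aq]; rewrite !in_itv/= !andbT; exact: lt_trans.
  by apply: bigcup_measurable => n _; exact: mq.
pose mf := isMeasurableFun.Build _ _ _ _ _ mpsi.
pose psim : {mfun measurableTypeR R >-> measurableTypeR R} := HB.pack psi mf.
by exists psim, N; split => // x Nx; rewrite -psiN.
Qed.

(** The sandwich for the preimage of B under psi is taken for the law of a
    Borel version h of phi, then pulled back by h. *)
Lemma univ_measurable_comp (phi psi : R -> R) :
  univ_measurable_fun phi -> univ_measurable_fun psi ->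
  univ_measurable_fun (psi \o phi).
Proof.
move=> mphi mpsi B mB nu.
have [h [N [mN nuN phih]]] := univ_measurable_ae_borel nu mphi.
have [A [C [mA mC AB BC ACnu]]] := mpsi B mB (distribution nu h).
have mpre D : measurable D -> measurable (h @^-1` D).
  by move=> mD; rewrite -[X in measurable X]setTI; exact: measurable_funPT.
exists (h @^-1` A `\` N), (h @^-1` C `|` N); split.
- by apply: measurableD => //; exact: mpre.
- by apply: measurableU => //; exact: mpre.
- by move=> x [Ax Nx] /=; rewrite phih//; exact: AB.
- move=> x /= Bx; have [Nx|Nx] := pselect (N x); [by right|left].
  by apply: BC => /=; rewrite -phih.
- apply: (@subset_measure0 _ _ _ nu _ (h @^-1` (C `\` A) `|` N)).
  + apply: measurableD; first by apply: measurableU => //; exact: mpre.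
    by apply: measurableD => //; exact: mpre.
  + by apply: measurableU => //; apply: mpre; exact: measurableD.
  + move=> x [CNx AN]; have [Nx|Nx] := pselect (N x); [by right|left].
    by split; [case: CNx|move=> Ax; apply: AN].
  + by apply: null_set_setU => //; [apply: mpre; exact: measurableD].
Qed.

Lemma linear_growth_comp (phi psi : R -> R) :
  linear_growth phi -> linear_growth psi -> linear_growth (psi \o phi).
Proof.
move=> [a [b [a0 b0 phiE]]] [c [d [c0 d0 psiE]]].
exists (c * a), (c * b + d); split => [||x]; rewrite ?mulr_ge0 ?addr_ge0 ?mulr_ge0//.
rewrite /= (le_trans (psiE _))// addrA lerD2r -mulrA -mulrDr ler_wpM2l//.
Qed.

End UniversallyMeasurable.

(** * Invariance of the Lebesgue measure under isometries *)

Section LebesgueIsometry.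
Context {R : realType}.
Notation mu := (@lebesgue_measure R).

Definition mu_preserving (phi : R -> R) : Prop :=
  measurable_fun setT phi /\
  forall A : set R, measurable A -> mu (phi @^-1` A) = mu A.

(** Half-open intervals generate the Borel sets and determine the Lebesgue
    measure. *)
Lemma mu_preserving_of_itv (phi : R -> R) : measurable_fun setT phi ->
  (forall a b, a < b -> mu (phi @^-1` `]a, b]) = (b - a)%:E) -> mu_preserving phi.
Proof.
move=> mphi phiE; split => // A mA.
pose mf := isMeasurableFun.Build _ _ _ _ _ (mphi : measurable_fun
  (setT : set (measurableTypeR R)) (phi : _ -> measurableTypeR R)).
pose phim : {mfun measurableTypeR R >-> measurableTypeR R} := HB.pack phi mf.
apply/esym/(@lebesgue_measure_unique R (pushforward mu phim)) => //.
move=> _ [[a b] _ <-] /=; rewrite /pushforward/=.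
have [ab|ba] := ltP a b.
  by rewrite [RHS]phiE// lebesgue_measure_itv/= lte_fin ab.
by rewrite set_itv_ge ?bnd_simp -?leNgt// preimage_set0 !measure0.
Qed.

Lemma mu_preserving_shift (c : R) : mu_preserving (fun x => c + x).
Proof.
apply: mu_preserving_of_itv; first exact: measurable_funD.
move=> a b ab; have -> : (fun x => c + x) @^-1` `]a, b] = `]a - c, b - c]%classic.
  by apply/seteqP; split => x /=; rewrite !in_itv/= ltrBlDl lerBrDl.
by rewrite lebesgue_measure_itv/= lte_fin ltrD2r ab -EFinB; congr EFin; ring.
Qed.

Lemma mu_preserving_reflect (c : R) : mu_preserving (fun x => c - x).
Proof.
apply: mu_preserving_of_itv; first exact: measurable_funB.
move=> a b ab; have -> : (fun x => c - x) @^-1` `]a, b] = `[c - b, c - a[%classic.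
  apply/seteqP; split => x /=; rewrite !in_itv/=;
  by rewrite lerBlDl lerBlDr ltrBrDl ltrBrDr andbC.
by rewrite lebesgue_measure_itv/= lte_fin ltrD2l ltrN2 ab -EFinB; congr EFin; ring.
Qed.

Section Preserving.
Context (phi : R -> R) (phimu : mu_preserving phi).

Lemma mu_preserving_measurable (D : set R) : measurable D -> measurable (phi @^-1` D).
Proof.
by case: phimu => mphi _ mD; rewrite -[X in measurable X]setTI; exact: mphi.
Qed.

Lemma mu_preserving_ae (P : R -> Prop) :
  {ae mu, forall y, P y} -> {ae mu, forall x, P (phi x)}.
Proof.
move=> [N [mN N0 PN]]; exists (phi @^-1` N); split.
- exact: mu_preserving_measurable.
- by have [_ ->] := phimu.
- by move=> x nPx; exact: PN.
Qed.

Lemma mu_preserving_ge0_integral (D : set R) (f : R -> \bar R) : measurable D ->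
  measurable_fun D f -> (forall y, D y -> 0 <= f y)%E ->
  (\int[mu]_(x in phi @^-1` D) f (phi x) = \int[mu]_(y in D) f y)%E.
Proof.
have [mphi phiE] := phimu; move=> mD mf f0.
pose mfI := isMeasurableFun.Build _ _ _ _ _ (mphi : measurable_fun
  (setT : set (measurableTypeR R)) (phi : _ -> measurableTypeR R)).
pose phim : {mfun measurableTypeR R >-> measurableTypeR R} := HB.pack phi mfI.
rewrite -(@ge0_integral_pushforward _ _ _ _ R phim _ mu D f)//; last first.
  by move=> y /set_mem; exact: f0.
by apply: eq_measure_integral => A mA _; exact: phiE.
Qed.

Lemma mu_preserving_integral (D : set R) (f : R -> \bar R) : measurable D ->
  measurable_fun D f ->
  (\int[mu]_(x in phi @^-1` D) f (phi x) = \int[mu]_(y in D) f y)%E.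
Proof.
move=> mD mf; rewrite integralE [RHS]integralE.
congr (_ - _)%E.
- rewrite -(@mu_preserving_ge0_integral D f^\+%E)//; last exact: measurable_funepos.
  by under eq_integral do rewrite (funepos_comp f phi).
- rewrite -(@mu_preserving_ge0_integral D f^\-%E)//; last exact: measurable_funeneg.
  by under eq_integral do rewrite (funeneg_comp f phi).
Qed.

Lemma mu_preserving_Rintegral (D : set R) (f : R -> R) : measurable D ->
  measurable_fun D f ->
  \int[mu]_(x in phi @^-1` D) f (phi x) = \int[mu]_(y in D) f y.
Proof.
move=> mD mf; rewrite /Rintegral; congr fine.
by apply: (@mu_preserving_integral D (EFin \o f)) => //; exact/measurable_EFinP.
Qed.

Lemma mu_preserving_measurable_fun d (T : measurableType d) (D : set R)
    (f : R -> T) : measurable D -> measurable_fun D f ->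
  measurable_fun (phi @^-1` D) (f \o phi).
Proof.
move=> mD mf; apply: (measurable_comp mD) => //; first exact: image_preimage_subset.
by apply: measurable_funTS; case: phimu.
Qed.

Lemma mu_preserving_integrable (D : set R) (f : R -> R) : measurable D ->
  mu.-integrable D (EFin \o f) ->
  mu.-integrable (phi @^-1` D) (EFin \o (f \o phi)).
Proof.
move=> mD /integrableP[mf foo]; apply/integrableP; split.
  exact: (@mu_preserving_measurable_fun _ _ D (EFin \o f)).
rewrite (@mu_preserving_ge0_integral D (fun x => `|(f x)%:E|%E))//.
exact: measurableT_comp.
Qed.

End Preserving.
End LebesgueIsometry.

(** * Fubini on a triangle *)

Section Triangle.
Context {R : realType}.
Notation mu := (@lebesgue_measure R).

(** Form in which the inner integrals appear after extension by 0: the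
    integrand is scaled by a constant and supported in A. *)
Lemma integral_scale_patch (f : R -> R) (A I : set R) (k : R) :
  measurable I -> measurable A -> A `<=` I -> mu.-integrable I (EFin \o f) ->
  (\int[mu]_s (k * (f \_ A) s)%:E)%E = (k * \int[mu]_(s in A) f s)%:E.
Proof.
move=> mI mA AI fI.
have fA : mu.-integrable A (EFin \o f).
  by apply: (@integrableS _ _ _ mu I A) => //.
have fAT : mu.-integrable setT (EFin \o (f \_ A)).
  by move: fA; rewrite integrable_mkcond//= restrict_EFin.
under eq_integral do rewrite EFinM.
rewrite integralZl// [in RHS]Rintegral_mkcond /Rintegral EFinM fineK//.
exact: integrable_fin_num.
Qed.

(** Exchange of the order of integration on the triangle 0 <= s <= x <= 1.  With
    h the derivative of a test function, this is the integration by parts that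
    needs only integrability of w. *)
Lemma Rintegral_triangle (w h : R -> R) :
  mu.-integrable `[0, 1] (EFin \o w) -> mu.-integrable `[0, 1] (EFin \o h) ->
  \int[mu]_(x in `[0, 1]) ((\int[mu]_(s in `[0, x]) w s) * h x) =
  \int[mu]_(s in `[0, 1]) (w s * \int[mu]_(x in `[s, 1]) h x).
Proof.
move=> iw ih; pose I : set R := `[0, 1]%classic.
have mI : measurable I by exact: measurable_itv.
pose W : R -> R := w \_ I; pose H : R -> R := h \_ I.
have iW : mu.-integrable setT (EFin \o W).
    by move: iw; rewrite integrable_mkcond//= restrict_EFin.
have iH : mu.-integrable setT (EFin \o H).
  by move: ih; rewrite integrable_mkcond//= restrict_EFin.
have mW : measurable_fun setT W by apply/measurable_EFinP; exact: measurable_int iW.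
have mH : measurable_fun setT H by apply/measurable_EFinP; exact: measurable_int iH.
pose F (xs : measurableTypeR R * measurableTypeR R) : \bar R :=
  (W xs.2 * H xs.1 * (xs.2 <= xs.1)%R%:R)%:E.
have mF : measurable_fun setT F.
  apply/measurable_EFinP; apply: measurable_funM.
    apply: measurable_funM.
      exact: (measurableT_comp mW measurable_snd).
    exact: (measurableT_comp mH measurable_fst).
  have -> : (fun xs : measurableTypeR R * measurableTypeR R => (xs.2 <= xs.1)%R%:R) =
      (fun b : bool => b%:R : R) \o
      (fun xs : measurableTypeR R * measurableTypeR R => xs.2 <= xs.1) by [].
  apply: measurableT_comp => //.
  by apply: measurable_fun_ler.
have mabsF : measurable_fun setT (abse \o F) by exact: measurableT_comp.
have iaW := integrable_abse iW; have iaH := integrable_abse iH.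
have iF : (mu \x mu)%E.-integrable setT F.
  apply/integrable12ltyP => //.
  pose C := (\int[mu]_s `|(W s)%:E|)%E.
  have C0 : (0 <= C)%E by exact: integral_ge0.
  have Coo : (C < +oo)%E by exact: (integrable_lty _ iaW).
  have maH : measurable_fun setT (fun x => `|(H x)%:E|%E) by exact: measurable_int iaH.
  have maW : measurable_fun setT (fun x => `|(W x)%:E|%E) by exact: measurable_int iaW.
  apply: (@le_lt_trans _ _ (\int[mu]_x (C * `|(H x)%:E|))%E).
    apply: ge0_le_integral => //.
    - by move=> x _; apply: integral_ge0.
    - by apply: (measurable_fun_fubini_tonelli_F (abse \o F)) => // xs; exact: abse_ge0.
    - exact: measurable_funeM.
    - move=> x _; rewrite muleC -ge0_integralZl//.
      apply: ge0_le_integral => //.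
      + exact: (measurableT_comp mabsF (measurable_pair1 x)).
      + exact: measurable_funeM.
      + move=> s _; rewrite /F/= lee_fin !normrM mulrC mulrA.
        rewrite [`|H x| * _]mulrC -[leRHS]mul1r -mulrA ler_wpM2r ?mulr_ge0//.
        by case: (s <= x); rewrite ?normr1 ?normr0.
  rewrite ge0_integralZl//; apply: lte_mul_pinfty => //.
    by rewrite ge0_fin_numE.
  exact: (integrable_lty _ iaH).
have FE := @Fubini _ _ _ _ _ mu mu F iF.
rewrite [LHS]Rintegral_mkcond [RHS]Rintegral_mkcond /Rintegral; congr fine.
have -> : (\int[mu]_x (((fun x => (\int[mu]_(s in `[0, x]) w s) * h x) \_ I) x)%:E =
    \int[mu]_x \int[mu]_s F (x, s))%E.
  apply: eq_integral => x _; rewrite patchE; case: ifPn => xI.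
    have := xI; rewrite inE /I/= in_itv/= => /andP[x0 x1].
    have xI' : `[0, x]%classic `<=` I.
      by move=> s; rewrite /I/= !in_itv/= => /andP[-> /le_trans->].
    rewrite mulrC -(integral_scale_patch _ mI _ xI')//.
    apply: eq_integral => s _; congr EFin.
    rewrite /W /H !patchE xI; case: ifPn => [sx|sNx].
      have := sx; rewrite inE /I/= in_itv/= => /andP[_ ->].
      by rewrite mem_set ?mulr1 1?mulrC//; apply: xI'; exact: set_mem.
    have [sI|sI] := boolP (s \in I); last by rewrite mul0r mul0r mulr0.
    have [sx|_] := boolP (s <= x); last by rewrite !mulr0.
    move: sI sNx; rewrite notin_setE inE /I/= !in_itv/= => /andP[-> _].
    by rewrite sx => /(_ isT).
  rewrite integral0_eq// => s _; rewrite /F /H /= patchE (negbTE xI).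
  by rewrite mulr0 mul0r.
rewrite FE; apply: eq_integral => s _; rewrite patchE; case: ifPn => sI.
  have := sI; rewrite inE /I/= in_itv/= => /andP[s0 s1].
  have sI' : `[s, 1]%classic `<=` I.
    by move=> x; rewrite /I/= !in_itv/= => /andP[/(le_trans s0)-> ->].
  rewrite -(integral_scale_patch _ mI _ sI')//.
  apply: eq_integral => x _; congr EFin.
  rewrite /F/= /W /H !patchE sI; case: (boolP (x \in `[s, 1]%classic)) => [sx|sNx].
    have := sx; rewrite inE/= in_itv/= => /andP[-> _].
    by rewrite mem_set ?mulr1//; apply: sI'; exact: set_mem.
  have [xI|xI] := boolP (x \in I); last first.
    by have -> : (point : R) = 0 by []; rewrite mulr0 mul0r.
  have [sx|_] := boolP (s <= x); last by rewrite !mulr0.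
  move: xI sNx; rewrite notin_setE inE /I/= !in_itv/= => /andP[_ ->].
  by rewrite sx => /(_ isT).
rewrite integral0_eq// => x _; rewrite /F /W /= patchE (negbTE sI).
by rewrite mul0r mul0r.
Qed.
End Triangle.

(** * Primitives have weak derivatives *)

Section WeakDerivative.
Context {R : realType}.
Notation mu := (@lebesgue_measure R).

Lemma Rintegral_itv_oo (a b : R) (f : R -> R) (b0 b1 : bool) :
  measurable_fun `]a, b[ f ->
  \int[mu]_(z in [set` Interval (BSide b0 a) (BSide b1 b)]) f z =
  \int[mu]_(z in `]a, b[) f z.
Proof.
by move=> mf; rewrite /Rintegral integral_itv_bndoo//; exact/measurable_EFinP.
Qed.

Lemma continuous_bounded_itv (h : R -> R) (a b : R) : continuous h ->
  [bounded h x | x in `[a, b]].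
Proof.
move=> ch; have /compact_bounded : compact (h @` `[a, b]).
  by apply: continuous_compact; [exact: continuous_subspaceT|exact: segment_compact].
move=> [M [Mr Mh]]; exists M; split => // x xM y yab.
by apply: Mh xM _ _; exists y.
Qed.

Lemma integrable_mul_continuous (w h : R -> R) (a b : R) : continuous h ->
  mu.-integrable `[a, b] (EFin \o w) ->
  mu.-integrable `[a, b] (EFin \o (fun x => w x * h x)).
Proof.
move=> ch iw; apply: (integrableMl _ iw) => //.
  by apply: measurable_funTS; exact: continuous_measurable_fun.
exact: continuous_bounded_itv.
Qed.

Lemma test_function_continuous (phi : R -> R) : test_function phi -> continuous phi.
Proof. by move=> [dphi _ _] x; apply/differentiable_continuous/derivable1_diffP. Qed.

Lemma test_function0 (phi : R -> R) : test_function phi -> phi 0 = 0.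
Proof.
move=> [_ _ [a [b [a0 b1 phi0]]]]; apply: phi0.
by rewrite in_itv/= leNgt a0.
Qed.

Lemma test_function1 (phi : R -> R) : test_function phi -> phi 1 = 0.
Proof.
move=> [_ _ [a [b [a0 b1 phi0]]]]; apply: phi0.
by rewrite in_itv/= andbC leNgt b1.
Qed.

Lemma Rintegral_test_function (phi : R -> R) (s : R) : test_function phi ->
  s <= 1 -> \int[mu]_(x in `[s, 1]) derive1 phi x = - phi s.
Proof.
move=> tphi; rewrite le_eqVlt => /predU1P[->|s1].
  by rewrite set_itv1 Rintegral_set1 test_function1// oppr0.
have [dphi cphi' _] := tphi; have cphi := test_function_continuous tphi.
rewrite /Rintegral (@continuous_FTC2 _ _ phi)//; last 2 first.
- exact: continuous_subspaceT.
- split=> [x _||]; first exact: dphi.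
  + by apply: cvg_at_right_filter; exact: cphi.
  + by apply: cvg_at_left_filter; exact: cphi.
by rewrite test_function1// -EFinB/= sub0r.
Qed.

(** Fubini moves the inner integral onto phi', whose integral over [s, 1] is
    - phi s; the constant C is killed because phi vanishes at 0 and 1. *)
Lemma weak_derivative_primitive (u w : R -> R) (C : R) :
  mu.-integrable `[0, 1] (EFin \o w) ->
  (forall x, 0 < x < 1 -> u x = C + \int[mu]_(s in `[0, x]) w s) ->
  weak_derivative u w.
Proof.
move=> iw uE.
have sub01 : (`]0, 1[ : set R) `<=` `[0, 1].
  by move=> x; rewrite /= !in_itv/= => /andP[/ltW-> /ltW->].
pose P x := \int[mu]_(s in `[0, x]) w s.
have cP : {within `[0, 1], continuous P}.
  by apply: parameterized_integral_continuous.
have iP : mu.-integrable `[0, 1] (EFin \o P).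
  by apply: continuous_compact_integrable => //; exact: segment_compact.
have iC (c : R) : mu.-integrable `[0, 1] (EFin \o cst c).
  apply: continuous_compact_integrable; first exact: segment_compact.
  by apply: continuous_subspaceT => x; exact: cst_continuous.
have iCP : mu.-integrable `[0, 1] (EFin \o (fun x => C + P x)).
  by apply: (@integrableD _ _ _ mu _ _ (EFin \o cst C) (EFin \o P)).
have o01 : open (`]0, 1[%classic : set R) by exact: interval_open.
split.
- apply: open_integrable_locally => //.
  apply: (@eq_integrable _ _ _ mu _ _ (EFin \o (fun x => C + P x))) => //.
    by move=> x; rewrite inE/= in_itv/= => x01; rewrite uE.
  exact: integrableS iCP.
- apply: open_integrable_locally => //.
  exact: integrableS iw.
- move=> phi tphi; have [dphi cphi' _] := tphi.
  have cphi := test_function_continuous tphi.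
  have mw : measurable_fun (`[0, 1]%classic : set R) w.
    by apply/measurable_EFinP; exact: measurable_int iw.
  have mP : measurable_fun (`[0, 1]%classic : set R) P.
    by apply/measurable_EFinP; exact: measurable_int iP.
  have iwphi : mu.-integrable `[0, 1] (EFin \o (fun x => w x * phi x)).
    exact: integrable_mul_continuous.
  have iPphi : mu.-integrable `[0, 1] (EFin \o (fun x => P x * derive1 phi x)).
    exact: integrable_mul_continuous.
  have iCphi : mu.-integrable `[0, 1] (EFin \o (fun x => C * derive1 phi x)).
    exact: (integrable_mul_continuous cphi' (iC C)).
  have iphi' : mu.-integrable `[0, 1] (EFin \o derive1 phi).
    apply: continuous_compact_integrable; first exact: segment_compact.
    exact: continuous_subspaceT.
  rewrite (@eq_Rintegral _ _ _ mu _
    (fun x => C * derive1 phi x + P x * derive1 phi x)); last first.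
    by move=> x; rewrite inE/= in_itv/= => x01; rewrite uE// mulrDl.
  rewrite -!(@Rintegral_itv_oo _ _ _ true false); last 2 first.
  - have i : mu.-integrable `]0, 1[ (EFin \o (fun x => w x * phi x)).
      exact: integrableS iwphi.
    by apply/measurable_EFinP; exact: measurable_int i.
  - have i : mu.-integrable `]0, 1[
        (EFin \o (fun x => C * derive1 phi x + P x * derive1 phi x)).
      apply: integrableS (integrableD _ iCphi iPphi) => //.
    by apply/measurable_EFinP; exact: measurable_int i.
  rewrite RintegralD// RintegralZl// Rintegral_test_function//.
  rewrite test_function0// oppr0 mulr0 add0r Rintegral_triangle//.
  rewrite -[RHS]mulN1r -RintegralZl//; apply: eq_Rintegral => s.
  rewrite inE/= in_itv/= => /andP[_ s1]; rewrite Rintegral_test_function//.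
  by rewrite mulrN mulN1r.
Qed.

End WeakDerivative.

(** * Uniqueness of weak derivatives *)

Section Bump.
Context {R : realType}.
Notation mu := (@lebesgue_measure R).

Let q (y : R) := Num.max 0 y ^+ 2.

Lemma max0_continuous : continuous (fun y : R => Num.max 0 y).
Proof.
move=> y; apply: continuous_max => //; exact: cst_continuous.
Qed.

(** A second-order remainder bound uniform in the signs of y and h + y, which
    gives the derivative of max(0, y)^2 without distinguishing y = 0. *)
Lemma sqr_max0_remainder (y h : R) :
  `|q (h + y) - q y - h * (2 * Num.max 0 y)| <= h ^+ 2.
Proof.
rewrite /q ler_norml.
by case: (lerP 0 (h + y)) => hy0; case: (lerP 0 y) => y0; apply/andP; split; nra.
Qed.

Lemma is_derive_sqr_max0 (y : R) : is_derive y 1 q (2 * Num.max 0 y).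
Proof.
have qy : h^-1 *: (q (h *: 1 + y) - q y) @[h --> 0^'] --> 2 * Num.max 0 y.
  apply/cvgrPdist_le => e e0; near=> h.
  have h0 : h != 0 by near: h; exact: nbhs_dnbhs_neq.
  have he : `|h| <= e by near: h; exact: dnbhs0_le.
  have hgt0 : 0 < `|h| by rewrite normr_gt0.
  rewrite [h *: 1]mulr1 -[_ *: _]/(h^-1 * _) -(ler_pM2l hgt0) -normrM mulrBr mulVKf// distrC.
  rewrite (le_trans (sqr_max0_remainder y h))// -real_normK ?num_real// expr2.
  by rewrite ler_wpM2l.
apply: DeriveDef; first by apply/cvg_ex; eexists; exact: qy.
exact/cvg_lim.
Unshelve. all: by end_near. Qed.

Section Plateau.
Context (c d : R) (cd : c < d).

Definition bump (x : R) := q ((x - c) * (d - x)).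

(** As n grows, 1 - (1 - bump)^n increases to the indicator of ]c, d[, and it
    inherits its regularity and its support from the single function bump. *)
Definition plateau n (x : R) := 1 - (1 - bump x) ^+ n.+1.

Definition bump' (x : R) := 2 * Num.max 0 ((x - c) * (d - x)) * (c + d - 2 * x).

Lemma is_derive_bump (x : R) : is_derive x 1 bump (bump' x).
Proof.
have dp : is_derive x 1 (fun x : R => (x - c) * (d - x)) (c + d - 2 * x).
  apply: is_derive_eq; rewrite /GRing.scale/=; ring.
have := @is_derive1_comp _ q (fun x => (x - c) * (d - x)) x _ _
  (is_derive_sqr_max0 _) dp.
by rewrite /bump' mulrC.
Qed.

Lemma is_derive_plateau n (x : R) :
  is_derive x 1 (plateau n) (n.+1%:R * (1 - bump x) ^+ n * bump' x).
Proof.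
have db := is_derive_bump x.
have d1b : is_derive x 1 (cst 1 - bump) (0 - bump' x) by exact: is_deriveB.
have dX : is_derive x 1 (cst 1 - (cst 1 - bump) ^+ n.+1)
    (0 - (n.+1%:R * (cst 1 - bump) x ^+ n) *: (0 - bump' x)) by exact: is_deriveB.
have -> : plateau n = cst 1 - (cst 1 - bump) ^+ n.+1.
  by apply/funext => y; rewrite /plateau !fctE.
by apply: (@is_derive_eq _ _ _ _ _ _ _ _ dX); rewrite fctE /GRing.scale/=; ring.
Qed.

Lemma bump_continuous : continuous bump.
Proof.
by move=> x; apply/differentiable_continuous/derivable1_diffP; case: (is_derive_bump x).
Qed.

Lemma bump_out x : ~~ (c < x < d) -> bump x = 0.
Proof.
move=> xcd; rewrite /bump /q max_l ?expr0n//; move: xcd.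
rewrite negb_and -!leNgt => /orP[xc|dx].
  by rewrite mulr_le0_ge0 ?subr_le0 ?subr_ge0// (le_trans xc)// ltW.
by rewrite mulr_ge0_le0 ?subr_le0 ?subr_ge0// (le_trans _ dx)// ltW.
Qed.

Lemma plateau_test_function n : 0 < c -> d < 1 -> test_function (plateau n).
Proof.
move=> c0 d1; split.
- by move=> x; case: (is_derive_plateau n x).
- have -> : derive1 (plateau n) = (fun x => n.+1%:R * (1 - bump x) ^+ n * bump' x).
    by apply/funext => x; rewrite derive1E; have [_ ->] := is_derive_plateau n x.
  move=> x; apply: cvgM; first apply: cvgM; first exact: cvg_cst.
    apply: (continuous_comp (f := fun y => 1 - bump y) (g := fun z => z ^+ n)).
      by apply: cvgB; [exact: cvg_cst|exact: bump_continuous].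
    exact: exprn_continuous.
  apply: cvgM.
    apply: cvgM; first exact: cvg_cst.
    apply: (continuous_comp (f := fun y => (y - c) * (d - y)) (g := fun z => Num.max 0 z)).
      apply: cvgM; apply: cvgB; by [exact: cvg_cst|exact: cvg_id].
    exact: max0_continuous.
  by apply: cvgB; [exact: cvg_cst|apply: cvgM; [exact: cvg_cst|exact: cvg_id]].
- exists c, d; split => // x; rewrite in_itv/= => xcd.
  rewrite /plateau bump_out ?subr0 ?expr1n ?subrr//.
  by apply: contra xcd => /andP[/ltW-> /ltW->].
Qed.

Lemma plateau_out n x : ~~ (c < x < d) -> plateau n x = 0.
Proof. by move=> xcd; rewrite /plateau bump_out ?subr0 ?expr1n ?subrr. Qed.

(** The bound by 1 comes from (x - c) (d - x) <= 1 / 4 when c and d lie in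
    ]0, 1[; it makes (1 - bump)^n tend to 0 without any normalisation. *)
Lemma bump_itv x : 0 < c -> d < 1 -> c < x < d -> 0 < bump x < 1.
Proof.
move=> c0 d1 /andP[cx xd]; rewrite /bump /q.
have p0 : 0 < (x - c) * (d - x) by rewrite mulr_gt0// subr_gt0.
by rewrite max_r ?(ltW p0)// exprn_gt0//= expr_lt1// ?(ltW p0)//; nra.
Qed.

Lemma plateau_itv n x : 0 < c -> d < 1 -> 0 <= plateau n x <= 1.
Proof.
move=> c0 d1; have [xcd|xcd] := boolP (c < x < d); last first.
  by rewrite plateau_out// lexx ler01.
have /andP[b0 b1] := bump_itv c0 d1 xcd.
rewrite /plateau subr_ge0 lerBlDr lerDl exprn_ge0 ?subr_ge0 ?(ltW b1)// andbT.
by rewrite exprn_ile1// ?subr_ge0 ?(ltW b1)// lerBlDr lerDl ltW.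
Qed.

Lemma cvg_plateau x : 0 < c -> d < 1 -> c < x < d ->
  plateau n x @[n --> \oo] --> (1 : R).
Proof.
move=> c0 d1 /(bump_itv c0 d1)/andP[b0 b1].
rewrite -[X in _ --> X]subr0; apply: cvgB; first exact: cvg_cst.
rewrite (cvg_shiftS (fun n => (1 - bump x) ^+ n)).
by apply: cvg_expr; rewrite ger0_norm ?subr_ge0 ?(ltW b1)// ltrBlDr ltrDl.
Qed.

End Plateau.
End Bump.

Section Uniqueness.
Context {R : realType}.
Notation mu := (@lebesgue_measure R).

(** Dominated convergence along the plateaus, which tend boundedly to the
    indicator of ]c, d[. *)
Lemma Rintegral_test_function_eq0 (w : R -> R) (c d : R) :
  0 < c -> c < d -> d < 1 -> mu.-integrable `]c, d[ (EFin \o w) ->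
  (forall phi, test_function phi -> \int[mu]_(x in `]0, 1[) (w x * phi x) = 0) ->
  \int[mu]_(x in `]c, d[) w x = 0.
Proof.
move=> c0 cd d1 iw w0.
pose f_ n (x : R) := (w x * plateau c d n x)%:E.
have mw : measurable_fun `]c, d[ w by apply/measurable_EFinP; exact: measurable_int iw.
have f_0 n : (\int[mu]_(x in `]c, d[) f_ n x = 0)%E.
  have tn := plateau_test_function cd n c0 d1.
  have := w0 _ tn; rewrite Rintegral_mkcond.
  have -> : (fun x => w x * plateau c d n x) \_ `]0, 1[ =
     (fun x => w x * plateau c d n x) \_ `]c, d[.
    apply/funext => x; rewrite !patchE.
    have [xcd|xcd] := boolP (c < x < d).
      rewrite !mem_set//= in_itv/= ?xcd//.
      by case/andP: xcd => cx xd; rewrite (lt_trans c0 cx) (lt_trans xd d1).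
    by rewrite (plateau_out cd)// mulr0; case: ifP; case: ifP.
  rewrite -Rintegral_mkcond /Rintegral => /eqP; rewrite fine_eq0 => [/eqP//|].
  apply: integrable_fin_num => //.
  apply: (integrableMl _ iw) => //.
    apply: measurable_funTS; apply: continuous_measurable_fun.
    exact: test_function_continuous.
  exists 1; split=> // M M1 x _ /=.
  have /andP[p0 p1] := plateau_itv cd n x c0 d1.
  by rewrite ger0_norm// (le_trans p1)// ltW.
have cvgf : (\int[mu]_(x in `]c, d[) f_ n x)%E @[n --> \oo] -->
    (\int[mu]_(x in `]c, d[) (w x)%:E)%E.
  apply: (@dominated_cvg _ _ _ mu _ _ f_ _ (fun x => `|(w x)%:E|%E)) => //.
  - move=> n; apply/measurable_EFinP; apply: measurable_funM => //.
    apply: measurable_funTS; apply: continuous_measurable_fun.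
    by apply: test_function_continuous; exact: plateau_test_function.
  - move=> x; rewrite /= in_itv/= => xcd; apply/cvg_EFin; first exact: nearW.
    rewrite -[X in _ --> X]mulr1; apply: cvgM; first exact: cvg_cst.
    exact: cvg_plateau.
  - exact: integrable_abse iw.
  - move=> n x _; rewrite /f_ lee_fin normrM ler_piMr//.
    by have /andP[p0 p1] := plateau_itv cd n x c0 d1; rewrite ger0_norm.
rewrite /Rintegral; have -> // : (\int[mu]_(x in `]c, d[) (w x)%:E = 0)%E.
apply: (cvg_unique _ cvgf) => //.
by apply: cvg_near_cst; apply: nearW => n; exact: f_0.
Qed.

(** A primitive is continuous, so one that vanishes almost everywhere vanishes
    everywhere, and h is its derivative at every Lebesgue point of h. *)
Lemma ae_eq0_of_primitive (h : R -> R) (a b : R) :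
  mu.-integrable `[a, b] (EFin \o h) ->
  {ae mu, forall x, a < x < b -> \int[mu]_(s in `[a, x]) h s = 0} ->
  {ae mu, forall x, a < x < b -> h x = 0}.
Proof.
move=> ih aeh.
have [ba|ab] := leP b a.
  by apply: aeW => x /andP[ax xb]; move: (lt_le_trans (lt_trans ax xb) ba); rewrite ltxx.
pose P x := \int[mu]_(s in `[a, x]) h s.
have cP : {within `[a, b], continuous P}.
  by apply: parameterized_integral_continuous => //; exact: ltW.
(* P is nonzero near a point where it does not vanish, and a ball is not null. *)
have P0 x : a < x < b -> P x = 0.
  move=> xab; apply: contrapT => Px0.
  have [cPx _ _] := (continuous_within_itvP _ ab).1 cP.
  have Px : {for x, continuous P} by apply: cPx; rewrite in_itv.
  have : \forall y \near x, (a < y < b) && (P y != 0).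
    near=> y; apply/andP; split.
      by near: y; apply: near_in_itvoo; rewrite in_itv.
    by near: y; apply: (cvgr_neq0 _ Px); exact/eqP.
  move=> [e /= e0 xe]; case: aeh => N [mN N0 nN].
  have : (mu (ball x e) <= mu N)%E.
    apply: le_measure; rewrite ?inE//; first exact: measurable_ball.
    move=> y /xe /andP[yab Py]; apply: nN => /(_ yab) Py0.
    by move: Py; rewrite /P Py0 eqxx.
  by rewrite N0 lebesgue_measure_ball ?(ltW e0)// leNgt lte_fin mulrn_wgt0.
pose hab := h \_ `[a, b].
have ihab : mu.-integrable setT (EFin \o hab).
  by move: ih; rewrite integrable_mkcond//= restrict_EFin.
have lhab : locally_integrable setT hab.
  by apply: open_integrable_locally => //; exact: openT.
have ihaby (y : R) : mu.-integrable `[a, y] (EFin \o hab).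
  by apply: integrableS ihab.
have := @FTC1 R hab (BLeft a) ihaby lhab.
apply: (@filterS _ _ (ae_filter_ringOfSetsType mu)) => x + xab; have /andP[ax xb] := xab.
move=> /(_ _)[|_]; first by [].
rewrite /hab patchE mem_set/= ?in_itv/= ?(ltW ax) ?(ltW xb)// => <-.
rewrite derive1E (near_eq_derive (g := cst 0)) ?derive_cst//.
near=> y; have yab : a < y < b by near: y; apply: near_in_itvoo; rewrite in_itv.
rewrite -(P0 y yab); apply: eq_Rintegral => s; rewrite inE/= in_itv/= => /andP[sa sy].
rewrite patchE mem_set//= in_itv/= sa (le_trans sy)//.
by case/andP: yab => _ /ltW.
Unshelve. all: by end_near. Qed.

Lemma locally_integrable_itv (w : R -> R) (a b : R) :
  locally_integrable (`]0, 1[ : set R) w -> 0 < a -> b < 1 ->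
  mu.-integrable `[a, b] (EFin \o w).
Proof.
move=> [mw _ kw] a0 b1; have sub : (`[a, b] : set R) `<=` `]0, 1[.
  move=> x; rewrite /= !in_itv/= => /andP[ax xb].
  by rewrite (lt_le_trans a0 ax) (le_lt_trans xb b1).
apply/integrableP; split; last by apply: kw => //; exact: segment_compact.
by apply/measurable_EFinP; apply: measurable_funS mw.
Qed.

Lemma integrable_test_function (w phi : R -> R) :
  locally_integrable (`]0, 1[ : set R) w -> test_function phi ->
  mu.-integrable `]0, 1[ (EFin \o (fun x => w x * phi x)).
Proof.
move=> lw tphi; have [_ _ [a [b [a0 b1 phi0]]]] := tphi.
have cphi := test_function_continuous tphi.
have := integrable_mul_continuous cphi (locally_integrable_itv lw a0 b1).
rewrite integrable_mkcond//= => i.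
apply: eq_integrable (integrableS _ _ _ i) => // x _; rewrite patchE/=.
case: ifPn => // xab; rewrite phi0 ?mulr0//.
by apply: contra xab => xab; rewrite mem_set.
Qed.

(** Applied on the intervals [1/(n+3), 1 - 1/(n+3)], which exhaust ]0, 1[: a
    locally integrable function need not be integrable up to the endpoints. *)
Lemma weak_derivative_unique (u w1 w2 : R -> R) :
  weak_derivative u w1 -> weak_derivative u w2 ->
  {ae mu, forall x, 0 < x < 1 -> w1 x = w2 x}.
Proof.
move=> [lu lw1 w1E] [_ lw2 w2E].
pose w x := w1 x - w2 x.
have lw : locally_integrable (`]0, 1[ : set R) w by exact: locally_integrableB.
have w0 phi : test_function phi -> \int[mu]_(x in `]0, 1[) (w x * phi x) = 0.
  move=> tphi; rewrite (@eq_Rintegral _ _ _ mu _ (fun x => w1 x * phi x - w2 x * phi x)).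
    rewrite RintegralB//; do ?exact: integrable_test_function.
    by apply/eqP; rewrite subr_eq0 -eqr_opp -w1E// -w2E.
  by move=> x _; rewrite mulrBl.
have w0' (n : nat) : {ae mu, forall x, n.+3%:R^-1 < x < 1 - n.+3%:R^-1 -> w x = 0}.
  have a0 : 0 < n.+3%:R^-1 :> R by rewrite invr_gt0.
  have b1 : 1 - n.+3%:R^-1 < 1 :> R by rewrite ltrBlDr ltrDl.
  apply: ae_eq0_of_primitive; first exact: locally_integrable_itv.
  apply: aeW => x /andP[ax xb].
  have iw : mu.-integrable `]n.+3%:R^-1, x[ (EFin \o w).
    apply: integrableS (locally_integrable_itv lw a0 b1) => // y.
    by rewrite /= !in_itv/= => /andP[/ltW-> /ltW yx]; rewrite (le_trans yx)// ltW.
  rewrite Rintegral_itv_oo.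
    by apply: Rintegral_test_function_eq0 => //; exact: lt_trans b1.
  by apply/measurable_EFinP; exact: measurable_int iw.
have := ae_foralln w0'.
apply: (@filterS _ _ (ae_filter_ringOfSetsType mu)) => x xw /andP[x0 x1].
apply/eqP; rewrite -subr_eq0; apply/eqP.
pose m := Num.min x (1 - x).
have m0 : 0 < m by rewrite lt_min x0 subr_gt0.
pose n := Num.Def.archi_bound m^-1.
have nm : n.+3%:R^-1 < m.
  rewrite invf_plt ?posrE//; apply: lt_le_trans (archi_boundP _) _.
    by rewrite invr_ge0 ltW.
  by rewrite ler_nat -addn3 leq_addr.
apply: (xw n); move: nm; rewrite lt_min => /andP[-> nx].
by rewrite ltrBrDr addrC -ltrBrDr.
Qed.

Lemma wderiv_ae (u w : R -> R) : weak_derivative u w ->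
  weak_derivative u (wderiv u) /\ {ae mu, forall x, 0 < x < 1 -> wderiv u x = w x}.
Proof.
move=> uw; have duw : weak_derivative u (wderiv u) by apply: xgetPex; exists w.
by split => //; exact: weak_derivative_unique duw uw.
Qed.

End Uniqueness.

(** * The energy norm *)

Section Energy.
Context {R : realType}.
Notation mu := (@lebesgue_measure R).

Lemma lebesgue_measureT_gt0 : (0 < mu [set: R])%E.
Proof.
apply: (@lt_le_trans _ _ (mu `[0%R, 1%R]%classic)).
  by rewrite lebesgue_measure_itv/= lte_fin ltr01 oppr0 adde0 lte01.
by apply: le_measure; rewrite ?inE.
Qed.

Lemma Lnorm_oo_le (D : set R) (a : R -> R) (e : R) : 0 <= e ->
  {ae mu, forall x, D x -> `|a x| <= e} ->
  ('N[mu]_+oo%E [EFin \o (a \_ D)] <= e%:E)%E.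
Proof.
move=> e0 ae; rewrite unlock lebesgue_measureT_gt0; apply/ess_supP.
apply: (@filterS _ _ (ae_filter_ringOfSetsType mu)) ae => x ax.
rewrite /= lee_fin patchE; case: ifPn => [/set_mem/ax//|_].
by rewrite normr0.
Qed.

Lemma Lnorm_oo_ae (D : set R) (a : R -> R) (e : \bar R) :
  ('N[mu]_+oo%E [EFin \o (a \_ D)] <= e)%E ->
  {ae mu, forall x, D x -> (`|a x|%:E <= e)%E}.
Proof.
rewrite unlock lebesgue_measureT_gt0 => /ess_supP.
apply: (@filterS _ _ (ae_filter_ringOfSetsType mu)) => x ax Dx.
by move: ax; rewrite /= patchE mem_set.
Qed.

Lemma powR_sqrt2 (r : R) : Num.sqrt 2 `^ r = 2 `^ (r / 2).
Proof. by rewrite -powR12_sqrt// -powRrM mulrC. Qed.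

Section XnormE.
Context (u v w a b : R -> R) (uw : weak_derivative u w)
  (ma : measurable_fun (`]0, 1[%classic : set R) a)
  (mb : measurable_fun (`]0, 1[%classic : set R) b)
  (wva : forall x, 0 < x < 1 -> w x + v x = Num.sqrt 2 * a x)
  (wvb : forall x, 0 < x < 1 -> w x - v x = Num.sqrt 2 * b x).

Lemma ae_wderiv : {ae mu, forall x, 0 < x < 1 ->
  wderiv u x + v x = Num.sqrt 2 * a x /\ wderiv u x - v x = Num.sqrt 2 * b x}.
Proof.
have [_] := wderiv_ae uw.
apply: (@filterS _ _ (ae_filter_ringOfSetsType mu)) => x + x01.
by move=> /(_ x01) ->; rewrite wva// wvb.
Qed.

(** The factor 2^(-r/2) of the norm cancels the factors sqrt 2 that relate
    u' + v and u' - v to the two waves a and b. *)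
Lemma Xnorm_fin (r : R) :
  Xnorm r%:E u v = ((\int[mu]_(x in `]0%R, 1%R[) (`|a x| `^ r + `|b x| `^ r)%:E) `^ r^-1)%E.
Proof.
rewrite /Xnorm; congr (_ `^ _)%E.
have mpow (h : R -> R) : measurable_fun (`]0, 1[%classic : set R) h ->
    measurable_fun (`]0, 1[%classic : set R) (fun x => `|h x| `^ r).
  by move=> mh; apply: measurableT_comp (measurable_powR r) _; apply: measurableT_comp.
have mw : measurable_fun (`]0, 1[%classic : set R) (wderiv u).
  by have [[_ []]] := wderiv_ae uw.
have mw0 : measurable_fun (`]0, 1[%classic : set R) w by case: uw => _ [].
have mv : measurable_fun (`]0, 1[%classic : set R) v.
  apply: (@eq_measurable_fun _ _ _ _ _ (fun x => Num.sqrt 2 * a x - w x)).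
    by move=> x; rewrite inE/= in_itv/= => x01; rewrite -wva//; ring.
  by apply: measurable_funB => //; apply: measurable_funM.
rewrite (@ae_eq_integral _ _ _ mu `]0, 1[%classic
  (fun x => (2 `^ (r / 2) * (`|a x| `^ r + `|b x| `^ r))%:E))//; first last.
- have := ae_wderiv; apply: (@filterS _ _ (ae_filter_ringOfSetsType mu)) => x + x01.
  rewrite /= in_itv/= in x01; move=> /(_ x01)[-> ->].
  by rewrite !normrM !powRM// ger0_norm// powR_sqrt2 mulrDr.
- apply/measurable_EFinP; apply: measurable_funM => //.
  by apply: measurable_funD; exact: mpow.
- apply/measurable_EFinP.
  by apply: measurable_funD; apply: mpow; [exact: measurable_funD|exact: measurable_funB].
under eq_integral do rewrite EFinM.
rewrite ge0_integralZl//; last first.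
  by apply/measurable_EFinP; apply: measurable_funD; exact: mpow.
by rewrite muleA -EFinM -powRD ?addNr ?powRr0 ?mul1e// pnatr_eq0 implybT.
Qed.

Lemma Xnorm_oo_le (e : R) : 0 <= e ->
  {ae mu, forall x, 0 < x < 1 -> `|a x| <= e /\ `|b x| <= e} ->
  (Xnorm +oo%E u v <= e%:E)%E.
Proof.
move=> e0 abe; rewrite /Xnorm.
have s0 : 0 < Num.sqrt 2 :> R by rewrite sqrtr_gt0.
rewrite muleC lee_pdivrMr// ge_max.
have se0 : 0 <= e * Num.sqrt 2 by rewrite mulr_ge0// ltW.
have H : {ae mu, forall x, 0 < x < 1 ->
    `|wderiv u x + v x| <= e * Num.sqrt 2 /\ `|wderiv u x - v x| <= e * Num.sqrt 2}.
  move: ae_wderiv abe; apply: (@filterS2 _ _ (ae_filter_ringOfSetsType mu)).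
  move=> x + + x01 => /(_ x01)[-> ->] /(_ x01)[ae be].
  rewrite !normrM ger0_norm ?(ltW s0)// ![Num.sqrt 2 * _]mulrC.
  by split; rewrite ler_wpM2r// ltW.
apply/andP; split; apply: Lnorm_oo_le => //; move: H;
  by apply: (@filterS _ _ (ae_filter_ringOfSetsType mu)) => x H;
    rewrite /= in_itv/= => /H[].
Qed.

Lemma Xnorm_oo_ae (e : R) : (Xnorm +oo%E u v <= e%:E)%E ->
  {ae mu, forall x, 0 < x < 1 -> `|a x| <= e}.
Proof.
have s0 : 0 < Num.sqrt 2 :> R by rewrite sqrtr_gt0.
rewrite /Xnorm muleC lee_pdivrMr// ge_max => /andP[/Lnorm_oo_ae Na _].
move: ae_wderiv Na; apply: (@filterS2 _ _ (ae_filter_ringOfSetsType mu)).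
move=> x + + x01.
rewrite /= in_itv/= => /(_ x01)[-> _] /(_ x01).
by rewrite lee_fin normrM ger0_norm ?(ltW s0)// mulrC ler_pM2r.
Qed.

End XnormE.
End Energy.

(** * Lebesgue spaces on bounded intervals *)

Section LpInterval.
Context {R : realType}.
Notation mu := (@lebesgue_measure R).
Implicit Types (f : R -> R) (a b : R).

Lemma integrable_itv_cc f a b : mu.-integrable `]a, b[ (EFin \o f) ->
  mu.-integrable `[a, b] (EFin \o f).
Proof.
move=> /integrableP[mf foo]; apply/integrableP; split.
  apply/measurable_EFinP; apply: (@measurable_fun_itv_cc _ a b false true).
  exact/measurable_EFinP.
by rewrite integral_itv_bndoo//; exact: measurableT_comp.
Qed.

Lemma Lp_powR_integrable (r : R) (D : set R) f : 0 < r -> measurable D -> Lp r%:E D f ->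
  mu.-integrable D (fun x => (`|f x| `^ r)%:E).
Proof.
move=> r0 mD [mf]; rewrite /finite_norm unlock => Nf.
have r1 : r^-1 != 0 by rewrite invr_eq0 gt_eqF.
apply/integrableP; split.
  apply/measurable_EFinP; apply: (measurableT_comp (measurable_powR r)).
  exact: measurableT_comp.
apply: le_lt_trans (lty_poweRy r1 Nf).
rewrite [leLHS]integral_mkcond le_eqVlt; apply/predU1P; left.
apply: eq_integral => x _; rewrite /= !patchE; case: ifPn => xD.
  by rewrite ger0_norm// powR_ge0.
by rewrite normr0 powR0// gt_eqF.
Qed.

Lemma Lp_oo_bounded (D : set R) f : Lp +oo%E D f ->
  exists M, {ae mu, forall x, D x -> `|f x| <= M}.
Proof.
move=> [mf Nf]; exists (fine 'N[mu]_+oo%E [EFin \o (f \_ D)]).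
have : ('N[mu]_+oo%E [EFin \o (f \_ D)] <= (fine 'N[mu]_+oo%E [EFin \o (f \_ D)])%:E)%E.
  by rewrite fineK// ge0_fin_numE// Lnorm_ge0.
move=> /Lnorm_oo_ae; apply: (@filterS _ _ (ae_filter_ringOfSetsType mu)) => x H Dx.
by have := H Dx; rewrite lee_fin.
Qed.

(** L^p is contained in L^1 on a bounded interval: |f| <= 1 + |f|^r if p = r is
    finite, and |f| <= M almost everywhere if p = +oo. *)
Lemma Lp_integrable (p : \bar R) f a b : (1 <= p)%E -> Lp p `]a, b[ f ->
  mu.-integrable `]a, b[ (EFin \o f).
Proof.
move=> p1 Lf; have [mf _] := Lf.
have iC (C : R) : mu.-integrable `]a, b[ (EFin \o cst C).
  apply: (@integrableS _ _ _ mu `[a, b]%classic) => //.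
    by move=> x; rewrite /= !in_itv/= => /andP[/ltW-> /ltW->].
  apply: continuous_compact_integrable; first exact: segment_compact.
  by apply: continuous_subspaceT => x; exact: cst_continuous.
case: p => [r| |//] in p1 Lf *.
  have r0 : 0 < r by rewrite (lt_le_trans ltr01).
  have iN := Lp_powR_integrable r0 (measurable_itv _) Lf.
  have iS : mu.-integrable `]a, b[ (fun x => 1%:E + (`|f x| `^ r)%:E)%E.
    exact: (integrableD _ (iC 1) iN).
  apply: le_integrable iS => //; first exact/measurable_EFinP.
  move=> x _; rewrite /= lee_fin [leRHS]ger0_norm ?addr_ge0 ?powR_ge0//.
  have [f1|f1] := lerP `|f x| 1; first by rewrite (le_trans f1)// lerDl powR_ge0.
  by rewrite (le_trans (le1r_powR (ltW f1) (_ : 1 <= r)))// lerDr.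
have [M fM] := Lp_oo_bounded Lf.
apply/integrableP; split; first exact/measurable_EFinP.
apply: (@le_lt_trans _ _ (\int[mu]_(x in `]a, b[) (`|M|)%:E)%E).
  apply: ae_ge0_le_integral => //.
    by apply: measurableT_comp => //; exact/measurable_EFinP.
  move: fM; apply: (@filterS _ _ (ae_filter_ringOfSetsType mu)) => x H xab.
  by rewrite /= lee_fin (le_trans (H xab))// ler_norm.
exact: (integrable_lty _ (iC `|M|)).
Qed.

Lemma bounded_Lp (p : \bar R) (D : set R) f M : (1 <= p)%E -> measurable D ->
  (mu D < +oo)%E -> measurable_fun D f -> (forall x, D x -> `|f x| <= M) ->
  Lp p D f.
Proof.
move=> p1 mD Doo mf fM; split => //; rewrite /finite_norm.
case: p => [r| |//] in p1 *; last first.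
  apply: (@le_lt_trans _ _ (`|M|)%:E); last exact: ltry.
  apply: Lnorm_oo_le => //; apply: aeW => x Dx.
  by rewrite (le_trans (fM x Dx))// ler_norm.
have r0 : 0 < r by rewrite (lt_le_trans ltr01).
rewrite unlock; apply: poweR_lty.
apply: (@le_lt_trans _ _ (\int[mu]_(x in D) (`|M| `^ r)%:E)%E); last first.
  by rewrite integral_cst// lte_mul_pinfty// lee_fin powR_ge0.
have -> : (\int[mu]_x `|(EFin \o (f \_ D)) x| `^ r = \int[mu]_(x in D) (`|f x| `^ r)%:E)%E.
  rewrite [RHS]integral_mkcond; apply: eq_integral => x _; rewrite /= !patchE.
  by case: ifPn => // _; rewrite normr0 powR0// gt_eqF.
apply: ge0_le_integral => //.
- apply/measurable_EFinP; apply: (measurableT_comp (measurable_powR r)).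
  exact: measurableT_comp.
- move=> x Dx; rewrite lee_fin ge0_ler_powR ?nnegrE// ?(ltW r0)//.
  by rewrite (le_trans (fM x Dx))// ler_norm.
Qed.

Lemma bounded_Lploc (p : \bar R) (c : R) f M : (1 <= p)%E ->
  measurable_fun setT f -> (forall s, `|f s| <= M) -> Lploc p c f.
Proof.
move=> p1 mf fM; split=> [|T cT]; first exact: measurable_funTS.
apply: (@bounded_Lp _ _ _ M) => //; last exact: measurable_funTS.
by rewrite lebesgue_measure_itv/= lte_fin cT -EFinB ltry.
Qed.

End LpInterval.

(** * Weak derivative of a superposition of waves *)

Section Waves.
Context {R : realType}.
Notation mu := (@lebesgue_measure R).
Implicit Types (f g : R -> R) (z : R -> R -> R) (t x : R).

Lemma Rintegral_shift f t x : 0 <= t -> 0 <= x ->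
  mu.-integrable `[0, t + x] (EFin \o f) ->
  \int[mu]_(s in `[0, t + x]) f s =
  \int[mu]_(s in `[0, t]) f s + \int[mu]_(s in `[0, x]) f (t + s).
Proof.
move=> t0 x0 fi.
have mf : measurable_fun (`[t, t + x]%classic : set R) f.
  have /measurable_EFinP := measurable_int _ fi; apply: measurable_funS => //.
  by move=> s; rewrite /= !in_itv/= => /andP[ts ->]; rewrite (le_trans t0 ts).
have -> : `[0, x]%classic = (fun s => t + s) @^-1` `[t, t + x].
  by apply/seteqP; split=> s; rewrite /= !in_itv/= lerDl lerD2l.
rewrite (mu_preserving_Rintegral (mu_preserving_shift t))//.
have mf' : measurable_fun (`]t, t + x[%classic : set R) f.
  by apply: measurable_funS mf => // s; rewrite /= !in_itv/= => /andP[/ltW-> /ltW->].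
have -> : \int[mu]_(s in `[t, t + x]) f s = \int[mu]_(s in `]t, t + x]) f s.
  by rewrite !Rintegral_itv_oo.
rewrite -(@Rintegral_itvB _ f (BLeft 0) (BRight (t + x)) t)// ?bnd_simp ?lerDl//.
by rewrite [RHS]addrC subrK.
Qed.

Lemma Rintegral_reflect f t x : 0 <= x <= t ->
  mu.-integrable `[0, t] (EFin \o f) ->
  \int[mu]_(s in `[0, t - x]) f s =
  \int[mu]_(s in `[0, t]) f s - \int[mu]_(s in `[0, x]) f (t - s).
Proof.
move=> /andP[x0 xt] fi.
have mf : measurable_fun (`[t - x, t]%classic : set R) f.
  have /measurable_EFinP := measurable_int _ fi; apply: measurable_funS => //.
  move=> s; rewrite /= !in_itv/= => /andP[ts ->]; rewrite andbT (le_trans _ ts)//.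
  by rewrite subr_ge0.
have -> : `[0, x]%classic = (fun s => t - s) @^-1` `[t - x, t].
  by apply/seteqP; split=> s; rewrite /= !in_itv/= lerD2l lerN2 gerBl andbC.
rewrite (mu_preserving_Rintegral (mu_preserving_reflect t))//.
have mf' : measurable_fun (`]t - x, t[%classic : set R) f.
  by apply: measurable_funS mf => // s; rewrite /= !in_itv/= => /andP[/ltW-> /ltW->].
have -> : \int[mu]_(s in `[t - x, t]) f s = \int[mu]_(s in `]t - x, t]) f s.
  by rewrite !Rintegral_itv_oo.
rewrite -(@Rintegral_itvB _ f (BLeft 0) (BRight t) (t - x))// ?bnd_simp ?subr_ge0 ?gerBl//.
by rewrite subKr.
Qed.

Lemma integrable_shift f t : mu.-integrable `[t, t + 1] (EFin \o f) ->
  mu.-integrable `[0, 1] (EFin \o (fun s => f (t + s))).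
Proof.
have -> : `[0, 1]%classic = (fun s : R => t + s) @^-1` `[t, t + 1].
  by apply/seteqP; split=> s; rewrite /= !in_itv/= lerDl lerD2l.
exact: (mu_preserving_integrable (mu_preserving_shift t)).
Qed.

Lemma integrable_reflect f t : mu.-integrable `[t - 1, t] (EFin \o f) ->
  mu.-integrable `[0, 1] (EFin \o (fun s => f (t - s))).
Proof.
have -> : `[0, 1]%classic = (fun s : R => t - s) @^-1` `[t - 1, t].
  by apply/seteqP; split=> s; rewrite /= !in_itv/= lerD2l lerN2 gerBl andbC.
exact: (mu_preserving_integrable (mu_preserving_reflect t)).
Qed.

(** For t >= 1 both integrals run over the positive half-line, so that splitting
    them at t writes z (t, x) as a constant plus a primitive in x. *)
Lemma wave_weak_derivative f g z t : 1 <= t ->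
  (forall T, mu.-integrable `[0, T] (EFin \o f)) ->
  (forall T, mu.-integrable `[0, T] (EFin \o g)) ->
  (forall x, 0 <= x <= 1 -> z t x = (Num.sqrt 2)^-1 * oint 0 (t + x) f
                                  + (Num.sqrt 2)^-1 * oint 0 (t - x) g) ->
  weak_derivative (z t) (wave_x f g t).
Proof.
move=> t1 fi gi zE.
have t0 : 0 <= t by rewrite (le_trans ler01).
have fti : mu.-integrable `[0, 1] (EFin \o (fun s => f (t + s))).
  apply: integrable_shift; apply: integrableS (fi (t + 1)) => //.
  by move=> s; rewrite /= !in_itv/= => /andP[ts ->]; rewrite (le_trans t0 ts).
have gti : mu.-integrable `[0, 1] (EFin \o (fun s => g (t - s))).
  apply: integrable_reflect; apply: integrableS (gi t) => //.
  move=> s; rewrite /= !in_itv/= => /andP[ts ->]; rewrite andbT (le_trans _ ts)//.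
  by rewrite subr_ge0.
have dti : mu.-integrable `[0, 1] (EFin \o (fun s => f (t + s) - g (t - s))).
  exact: (integrableB _ fti gti).
have Z (h : R -> R) : mu.-integrable `[0, 1] (EFin \o h) ->
    mu.-integrable `[0, 1] (EFin \o (fun s => h s / Num.sqrt 2)).
  move=> hi.
  have : mu.-integrable `[0, 1] (fun s => ((Num.sqrt 2)^-1)%:E * (h s)%:E)%E.
    exact: (integrableZl _ _ hi).
  by apply: eq_integrable => // s _; rewrite /= -EFinM mulrC.
apply: (@weak_derivative_primitive _ _ _ ((Num.sqrt 2)^-1 *
  (\int[mu]_(s in `[0, t]) f s + \int[mu]_(s in `[0, t]) g s))).
  exact: Z dti.
move=> x /andP[x0 x1].
have sub : (`[0, x] : set R) `<=` `[0, 1].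
  by move=> s; rewrite /= !in_itv/= => /andP[-> sx]; rewrite (le_trans sx)// ltW.
have S1 (h : R -> R) : mu.-integrable `[0, 1] (EFin \o h) ->
    mu.-integrable `[0, x] (EFin \o h).
  by apply: integrableS.
rewrite zE ?(ltW x0) ?(ltW x1)// /oint addr_ge0 ?(ltW x0)//.
rewrite subr_ge0 (le_trans (ltW x1) t1).
rewrite Rintegral_shift ?(ltW x0)// Rintegral_reflect ?(ltW x0) ?(le_trans (ltW x1) t1)//.
rewrite /wave_x RintegralZr//; last exact: S1.
rewrite RintegralB//; [|exact: S1|exact: S1].
by ring.
Qed.

End Waves.

(** * Solutions as orbits *)

Section Solutions.
Context {R : realType}.
Notation mu := (@lebesgue_measure R).

Lemma Lploc_integrable (p : \bar R) (a b T : R) (f : R -> R) : (1 <= p)%E -> a <= b ->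
  Lploc p a f -> mu.-integrable `[b, T] (EFin \o f).
Proof.
move=> p1 ab [mf Lf].
pose T' := Num.max T (a + 1).
have aT' : a < T' by rewrite lt_max ltrDl ltr01 orbT.
apply: integrableS (integrable_itv_cc (Lp_integrable p1 (Lf _ aT'))) => //.
move=> s; rewrite /= !in_itv/= => /andP[bs sT].
by rewrite (le_trans ab bs) le_max sT.
Qed.

Lemma measurable_fun_shift (a t : R) (f : R -> R) : a <= t ->
  measurable_fun (`]a, +oo[%classic : set R) f ->
  measurable_fun (`]0, 1[%classic : set R) (fun x => f (t + x)).
Proof.
move=> at_ mf.
have : measurable_fun ((fun x => t + x) @^-1` `]a, +oo[) (f \o (fun x => t + x)).
  exact: (mu_preserving_measurable_fun (mu_preserving_shift t)).
apply: measurable_funS.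
  by apply: (mu_preserving_measurable (mu_preserving_shift t)).
move=> x; rewrite /= !in_itv/= andbT => /andP[x0 _].
by rewrite (le_lt_trans at_)// ltrDl.
Qed.

Lemma measurable_fun_reflect (a t : R) (f : R -> R) : a + 1 <= t ->
  measurable_fun (`]a, +oo[%classic : set R) f ->
  measurable_fun (`]0, 1[%classic : set R) (fun x => f (t - x)).
Proof.
move=> at_ mf.
have : measurable_fun ((fun x => t - x) @^-1` `]a, +oo[) (f \o (fun x => t - x)).
  exact: (mu_preserving_measurable_fun (mu_preserving_reflect t)).
apply: measurable_funS.
  by apply: (mu_preserving_measurable (mu_preserving_reflect t)).
move=> x; rewrite /= !in_itv/= andbT => /andP[_ x1].
by rewrite ltrBrDr (lt_le_trans _ at_)// ltrD2l.
Qed.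

Section Solution.
Context (p : \bar R) (Sigma : set (R * R)) (S : R -> set R)
  (z0 z1 : R -> R) (z : R -> R -> R) (f g : R -> R)
  (p1 : (1 <= p)%E) (gS : svgraph S = rotR @` Sigma)
  (sol : wave_solution_with p Sigma z0 z1 z f g).

Lemma solution_integrable_f T : mu.-integrable `[0, T] (EFin \o f).
Proof. by case: sol => Lf _ _ _ _; exact: Lploc_integrable Lf. Qed.

Lemma solution_integrable_g T : mu.-integrable `[0, T] (EFin \o g).
Proof. by case: sol => _ Lg _ _ _; apply: Lploc_integrable Lg => //; rewrite oppr_le0. Qed.

(** z (t, 0) is a primitive of f + g, up to the factor 1 / sqrt 2. *)
Lemma solution_antisym : {ae mu, forall x, 0 < x -> f x = - g x}.
Proof.
case: sol => _ _ zE zb _.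
have H (n : nat) : {ae mu, forall x, 0 < x < n%:R -> f x + g x = 0}.
  apply: ae_eq0_of_primitive.
    exact: (integrableD _ (solution_integrable_f n%:R) (solution_integrable_g n%:R)).
  move: zb; apply: (@filterS _ _ (ae_filter_ringOfSetsType mu)) => t + /andP[t0 _].
  move=> /(_ (ltW t0))[+ _]; rewrite zE ?(ltW t0) ?lexx ?ler01// /oint addr0 subr0 (ltW t0).
  rewrite -mulrDr RintegralD//; [|exact: solution_integrable_f|exact: solution_integrable_g].
  by move=> /eqP; rewrite mulf_eq0 invr_eq0 (negbTE sqrt2_neq0) => /eqP.
have := ae_foralln H; apply: (@filterS _ _ (ae_filter_ringOfSetsType mu)) => x xH x0.
apply/eqP; rewrite -addr_eq0; apply/eqP/(xH (Num.Def.archi_bound x)).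
by rewrite x0 archi_boundP// ltW.
Qed.

(** The boundary condition at t = s + 1 says g (s + 2) is in S (g s); shifting
    the exceptional null set by all even numbers leaves a null set. *)
Lemma solution_orbit : {ae mu, forall s, -1 <= s ->
  forall n, S (g (n.*2%:R + s)) (g (n.+1.*2%:R + s))}.
Proof.
have [_ _ _ zb _] := sol.
have H1 : {ae mu, forall t, 0 <= t -> S (g (t - 1)) (g (t + 1))}.
  move: zb (mu_preserving_ae (mu_preserving_shift 1) solution_antisym).
  apply: (@filterS2 _ _ (ae_filter_ringOfSetsType mu)) => t + + t0.
  move=> /(_ t0)[_ St] fgt.
  suff : svgraph S (g (t - 1), g (t + 1)) by [].
  rewrite gS; eexists; first exact: St.
  by rewrite rotR_traces ![t + 1]addrC fgt ?opprK// ltr_wpDr.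
have H2 (n : nat) : {ae mu, forall s, -1 <= s -> S (g (n.*2%:R + s)) (g (n.+1.*2%:R + s))}.
  have := mu_preserving_ae (mu_preserving_shift (n.*2%:R + 1)) H1.
  apply: (@filterS _ _ (ae_filter_ringOfSetsType mu)) => s + s1.
  have -> : n.*2%:R + 1 + s - 1 = n.*2%:R + s by ring.
  have -> : n.*2%:R + 1 + s + 1 = n.+1.*2%:R + s by rewrite doubleS -!natr1; ring.
  by apply; rewrite -addrA addr_ge0// addrC -lerBlDr sub0r.
have := ae_foralln H2; apply: (@filterS _ _ (ae_filter_ringOfSetsType mu)) => s H s1 n.
exact: H.
Qed.

Section AtTime.
Context (t : R) (t1 : 1 <= t).

Let t0 : 0 <= t. Proof. exact: le_trans t1. Qed.

Let wd : weak_derivative (z t) (wave_x f g t).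
Proof.
case: sol => _ _ zE _ _; apply: wave_weak_derivative => //.
- exact: solution_integrable_f.
- exact: solution_integrable_g.
- by move=> x x01; rewrite zE.
Qed.

Let mf : measurable_fun (`]0, 1[%classic : set R) (fun x => f (t + x)).
Proof. by case: sol => -[mf _] _ _ _ _; exact: measurable_fun_shift mf. Qed.

Let mg : measurable_fun (`]0, 1[%classic : set R) (fun x => - g (t - x)).
Proof.
case: sol => _ [mg _] _ _ _; apply: measurableT_comp => //.
by apply: measurable_fun_reflect mg; rewrite addNr.
Qed.

Let wva (x : R) : wave_x f g t x + wave_t f g t x = Num.sqrt 2 * f (t + x).
Proof.
apply: (mulIf sqrt2_neq0); rewrite mulrDl !divfK ?sqrt2_neq0//.
by rewrite mulrC mulrA -expr2 sqr_sqrtr//; ring.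
Qed.

Let wvb (x : R) : wave_x f g t x - wave_t f g t x = Num.sqrt 2 * - g (t - x).
Proof.
apply: (mulIf sqrt2_neq0); rewrite mulrBl !divfK ?sqrt2_neq0//.
by rewrite [RHS]mulrC mulrA -expr2 sqr_sqrtr//; ring.
Qed.

Lemma energy_fin (r : R) : energy r%:E z f g t =
  ((\int[mu]_(x in `]0%R, 1%R[) (`|f (t + x)| `^ r + `|g (t - x)| `^ r)%:E) `^ r^-1)%E.
Proof.
rewrite /energy (Xnorm_fin wd mf mg)//; congr (_ `^ _)%E.
by apply: eq_integral => x _; rewrite normrN.
Qed.

Lemma energy_oo_le (e : R) : 0 <= e ->
  {ae mu, forall x, 0 < x < 1 -> `|f (t + x)| <= e /\ `|g (t - x)| <= e} ->
  (energy +oo%E z f g t <= e%:E)%E.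
Proof.
move=> e0 H; apply: (Xnorm_oo_le wd (fun x _ => wva x) (fun x _ => wvb x) e0).
move: H; apply: (@filterS _ _ (ae_filter_ringOfSetsType mu)) => x H /H.
by rewrite normrN.
Qed.

Lemma energy_oo_ae (e : R) : (energy +oo%E z f g t <= e%:E)%E ->
  {ae mu, forall x, 0 < x < 1 -> `|f (t + x)| <= e}.
Proof. exact: (Xnorm_oo_ae wd (fun x _ => wva x) (fun x _ => wvb x)). Qed.

End AtTime.
End Solution.
End Solutions.

(** * Decay of bounded solutions *)

Section Stability.
Context {R : realType}.
Notation mu := (@lebesgue_measure R).

Lemma cvge0_le (E : R -> \bar R) : (forall t, (0 <= E t)%E) ->
  (forall e : R, 0 < e -> \forall t \near +oo, (E t <= e%:E)%E) ->
  E t @[t --> +oo] --> 0%E.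
Proof.
move=> E0 Ele; apply/fine_cvgP; split.
  have := Ele 1 ltr01; apply: filterS => t Et1.
  by rewrite ge0_fin_numE// (le_lt_trans Et1)// ltry.
apply/cvgrPdist_le => e e0; have := Ele e e0; apply: filterS => t Ete.
rewrite /= sub0r normrN ger0_norm ?fine_ge0// -lee_fin fineK//.
by rewrite ge0_fin_numE// (le_lt_trans Ete)// ltry.
Qed.

Lemma Xnorm_ge0 (p : \bar R) (u v : R -> R) : (0 <= Xnorm p u v)%E.
Proof.
rewrite /Xnorm; case: p => [r| |//]; first exact: poweR_ge0.
by rewrite mule_ge0// le_max Lnorm_ge0.
Qed.

(** The windows of integration have length 2, so the energy at time t is
    compared with the block ]-1, 3[ translated by 2 n with 2 n <= t < 2 n + 2. *)
Lemma double_floor (t : R) : 0 <= t ->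
  exists n : nat, n.*2%:R <= t < n.*2%:R + 2.
Proof.
move=> t0; exists (Num.truncn (t / 2)).
have /truncn_itv/andP[] : 0 <= t / 2 by rewrite divr_ge0.
rewrite ler_pdivlMr// ltr_pdivrMr// -!natrM !muln2 doubleS => -> /=.
by rewrite -addn2 natrD.
Qed.

Section Decay.
Context (p : \bar R) (Sigma : set (R * R)) (S : R -> set R)
  (z0 z1 : R -> R) (z : R -> R -> R) (f g : R -> R)
  (p1 : (1 <= p)%E) (gS : svgraph S = rotR @` Sigma)
  (sol : wave_solution_with p Sigma z0 z1 z f g)
  (clSS : closed (svgraph (svcomp S S)))
  (leS : forall x y, S x y -> `|y| <= `|x|)
  (ltSS : forall x y, svcomp S S x y -> (x, y) <> (0, 0) -> `|y| < `|x|).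

(** N depends on the bound M of g on the initial window and not on s, which
    is what the supremum norm needs. *)
Lemma solution_bounded_decay (M e : R) : 0 < e -> exists N : nat,
  {ae mu, forall s, -1 <= s -> `|g s| <= M ->
    forall n, (N <= n)%N -> `|g (n.*2%:R + s)| <= e}.
Proof.
move=> e0; have [N NP] := orbit_decay M clSS leS ltSS e0.
exists N; have := solution_orbit p1 gS sol.
apply: (@filterS _ _ (ae_filter_ringOfSetsType mu)) => s orb s1 gM n Nn.
by apply: (NP (fun n => g (n.*2%:R + s)) (orb s1) _ _ Nn); rewrite add0r.
Qed.

Lemma energy_oo_decay (e : R) : p = +oo%E -> 0 < e ->
  \forall t \near +oo, (energy +oo%E z f g t <= e%:E)%E.
Proof.
move=> poo e0; have [_ [mg Lg] _ _ _] := sol.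
have [|M gM] := @Lp_oo_bounded R `]-1, 3[%classic g.
  by rewrite -poo; apply: Lg; lra.
have [N NP] := solution_bounded_decay M e0.
have late (n : nat) : (N <= n)%N ->
    {ae mu, forall y, n.*2%:R - 1 < y < n.*2%:R + 3 -> `|g y| <= e}.
  move=> Nn; have H : {ae mu, forall s, -1 < s < 3 -> `|g (n.*2%:R + s)| <= e}.
    move: gM NP; apply: (@filterS2 _ _ (ae_filter_ringOfSetsType mu)).
    move=> s gM NP s13; apply: NP => //; first by case/andP: s13 => /ltW.
    by apply: gM; rewrite /= in_itv.
  have := mu_preserving_ae (mu_preserving_shift (- n.*2%:R)) H.
  apply: (@filterS _ _ (ae_filter_ringOfSetsType mu)) => y + yn.
  by rewrite addrA addrN add0r; apply; lra.
near=> t.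
have t1 : 1 <= t by near: t; apply: nbhs_pinfty_ge; exact: num_real.
have tN : N.*2%:R <= t by near: t; apply: nbhs_pinfty_ge; exact: num_real.
have [n /andP[nt tn]] := double_floor (le_trans ler01 t1).
have Nn : (N <= n)%N.
  rewrite -ltnS -ltn_double doubleS -(ltr_nat R) (le_lt_trans tN)//.
  by rewrite -addn2 natrD.
apply: (energy_oo_le p1 sol t1 (ltW e0)).
have fg := mu_preserving_ae (mu_preserving_shift t) (solution_antisym p1 sol).
have g1 := mu_preserving_ae (mu_preserving_shift t) (late n Nn).
have g2 := mu_preserving_ae (mu_preserving_reflect t) (late n Nn).
move: fg g1 g2; apply: (@filterS3 _ _ (ae_filter_ringOfSetsType mu)).
move=> x fg g1x g2x /andP[x0 x1]; rewrite fg ?normrN; last by lra.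
by split; [apply: g1x|apply: g2x]; lra.
Unshelve. all: by end_near. Qed.

End Decay.
End Stability.

(** * Decay of p-integrable solutions *)

Section FiniteDecay.
Context {R : realType}.
Notation mu := (@lebesgue_measure R).
Context (r : R) (Sigma : set (R * R)) (S : R -> set R)
  (z0 z1 : R -> R) (z : R -> R -> R) (f g : R -> R)
  (r1 : (1 <= r%:E)%E) (gS : svgraph S = rotR @` Sigma)
  (sol : wave_solution_with r%:E Sigma z0 z1 z f g)
  (clSS : closed (svgraph (svcomp S S)))
  (leS : forall x y, S x y -> `|y| <= `|x|)
  (ltSS : forall x y, svcomp S S x y -> (x, y) <> (0, 0) -> `|y| < `|x|).

Let r0 : 0 < r. Proof. by rewrite (lt_le_trans ltr01)// -lee_fin. Qed.

Let G (y : R) : \bar R := (`|g y| `^ r)%:E.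

Let G0 y : (0 <= G y)%E. Proof. by rewrite lee_fin powR_ge0. Qed.

Let mG : measurable_fun (`]-1, +oo[%classic : set R) G.
Proof.
case: sol => _ [mg _] _ _ _; apply/measurable_EFinP.
by apply: (measurableT_comp (measurable_powR r)); exact: measurableT_comp.
Qed.

Let mGn (n : nat) :
  measurable_fun (`]-1, 3[%classic : set R) (fun s => G (n.*2%:R + s)%R).
Proof.
have : measurable_fun ((fun x : R => n.*2%:R + x : R) @^-1` `]-1, +oo[)
    (G \o (fun x : R => n.*2%:R + x : R)).
  exact: (mu_preserving_measurable_fun (mu_preserving_shift _)).
apply: measurable_funS.
  by apply: (mu_preserving_measurable (mu_preserving_shift _)).
move=> x; rewrite /= !in_itv/= andbT => /andP[x0 _].
by rewrite (lt_le_trans x0)// lerDr.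
Qed.

Lemma block_integral_cvg0 :
  (\int[mu]_(s in `](-1)%R, 3%R[) G (n.*2%:R + s)%R)%E @[n --> \oo] --> 0%E.
Proof.
have orb := solution_orbit r1 gS sol.
have iG : mu.-integrable `]-1, 3[ G.
  case: sol => _ [_ Lg] _ _ _; apply: Lp_powR_integrable => //.
  by apply: Lg; lra.
have [||||_ _] := @dominated_convergence _ _ _ mu `]-1, 3[%classic _
  (fun n s => G (n.*2%:R + s)%R) (cst 0%E) G mGn _ _ iG _ => //.
- move: orb; apply: (@filterS _ _ (ae_filter_ringOfSetsType mu)) => s orb.
  rewrite /= in_itv/= => /andP[/ltW/orb Su _].
  apply/cvg_EFin; first exact: nearW.
  apply/cvgrPdist_le => e e0.
  have e0' : 0 < e `^ r^-1 by rewrite powR_gt0.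
  have [N NP] := orbit_decay `|g s| clSS leS ltSS e0'.
  exists N => // n /= Nn.
  rewrite sub0r normrN ger0_norm ?powR_ge0//.
  have -> : e = (e `^ r^-1) `^ r by rewrite -powRrM mulVf ?powRr1 ?gt_eqF// ltW.
  apply: ge0_ler_powR; rewrite ?nnegrE// ?(ltW r0)// ?(ltW e0')//.
  by apply: (NP (fun n => g (n.*2%:R + s))) => //; rewrite add0r.
- move: orb; apply: (@filterS _ _ (ae_filter_ringOfSetsType mu)) => s orb n.
  rewrite /= in_itv/= => /andP[/ltW/orb Su _].
  rewrite lee_fin ger0_norm ?powR_ge0//.
  apply: ge0_ler_powR; rewrite ?nnegrE// ?(ltW r0)//.
  have := orbit_nonincreasing leS Su (leq0n n).
  by rewrite add0r.
- by rewrite integral0.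
Qed.

(** ]t - 1, t[ and ]t, t + 1[ are disjoint and contained in the block
    ]2 n - 1, 2 n + 3[. *)
Lemma energy_fin_le (n : nat) (t : R) : 1 <= t -> n.*2%:R <= t < n.*2%:R + 2 ->
  (energy r%:E z f g t <=
    (\int[mu]_(s in `](-1)%R, 3%R[) G (n.*2%:R + s)%R) `^ r^-1)%E.
Proof.
move=> t1 /andP[nt tn].
have mpow (h : R -> R) : measurable_fun (`]0, 1[%classic : set R) h ->
    measurable_fun (`]0, 1[%classic : set R) (fun x => (`|h x| `^ r)%:E).
  move=> mh; apply/measurable_EFinP.
  by apply: (measurableT_comp (measurable_powR r)); exact: measurableT_comp.
have [[mf _] [mg _] _ _ _] := sol.
have t0 : 0 <= t by exact: le_trans t1.
have n0 : 0 <= n.*2%:R :> R by [].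
have mGS (a b : R) : -1 <= a -> measurable_fun (`]a, b[%classic : set R) G.
  move=> a1; apply: measurable_funS mG => // x.
  by rewrite /= !in_itv/= andbT => /andP[ax _]; exact: le_lt_trans ax.
have mft := measurable_fun_shift t0 mf.
have mgt : measurable_fun (`]0, 1[%classic : set R) (fun x => g (t + x)).
  by apply: measurable_fun_shift mg; rewrite (le_trans _ t0)// oppr_le0.
have mgt' : measurable_fun (`]0, 1[%classic : set R) (fun x => g (t - x)).
  by apply: measurable_fun_reflect mg; rewrite addNr.
rewrite (energy_fin r1 sol t1).
apply: gt0_ler_poweR; rewrite ?in_itv/= ?leey ?andbT ?invr_ge0 ?(ltW r0)//.
- by apply: integral_ge0 => x _; rewrite lee_fin addr_ge0// powR_ge0.
- exact: integral_ge0.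
under eq_integral do rewrite EFinD.
rewrite ge0_integralD//; first last.
- exact: mpow.
- exact: mpow.
have -> : (\int[mu]_(x in `]0%R, 1%R[) (`|f (t + x)| `^ r)%:E =
    \int[mu]_(x in `]0%R, 1%R[) G (t + x))%E.
  apply: ae_eq_integral => //; [exact: mpow|exact: mpow|].
  have := mu_preserving_ae (mu_preserving_shift t) (solution_antisym r1 sol).
  apply: (@filterS _ _ (ae_filter_ringOfSetsType mu)) => x fg.
  rewrite /= in_itv/= => /andP[x0 _].
  by rewrite fg ?normrN// ltr_wpDl.
have -> : `]0%R, 1%R[%classic = (fun x => t + x) @^-1` `]t, t + 1[.
  by apply/seteqP; split=> s; rewrite /= !in_itv/= ltrDl ltrD2l.
rewrite (mu_preserving_ge0_integral (mu_preserving_shift t))//; last first.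
  by apply: mGS; lra.
have -> : (fun x => t + x) @^-1` `]t, t + 1[ = (fun x => t - x) @^-1` `]t - 1, t[.
  by apply/seteqP; split=> s; rewrite /= !in_itv/=; lra.
rewrite (mu_preserving_ge0_integral (mu_preserving_reflect t) (f := G))//; last first.
  by apply: mGS; lra.
have -> : `]-1, 3[%classic = (fun x : R => n.*2%:R + x : R) @^-1` `]n.*2%:R - 1, n.*2%:R + 3[.
  by apply/seteqP; split=> s; rewrite /= !in_itv/=; lra.
rewrite (mu_preserving_ge0_integral (mu_preserving_shift _))//; last first.
  by apply: mGS; lra.
rewrite -ge0_integral_setU//.
- apply: ge0_subset_integral => //.
  + exact: measurableU.
  + by apply: mGS; lra.
  + by move=> x [|]; rewrite /= !in_itv/=; lra.
- by apply/measurable_funU => //; split; apply: mGS; lra.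
- by apply/disj_set2P/seteqP; split => x //= -[]; rewrite !in_itv/=; lra.
Qed.

Lemma energy_fin_decay (e : R) : 0 < e ->
  \forall t \near +oo, (energy r%:E z f g t <= e%:E)%E.
Proof.
move=> e0; have er0 : 0 < e `^ r by rewrite powR_gt0.
have [[K _ KP] /cvgrPdist_le /(_ _ er0)[L _ LP]] := (fine_cvgP _ _).1 block_integral_cvg0.
pose N := maxn K L.
near=> t.
have t1 : 1 <= t by near: t; apply: nbhs_pinfty_ge; exact: num_real.
have tN : N.*2%:R <= t by near: t; apply: nbhs_pinfty_ge; exact: num_real.
have [n ntn] := double_floor (le_trans ler01 t1).
have Nn : (N <= n)%N.
  rewrite -ltnS -ltn_double doubleS -(ltr_nat R) (le_lt_trans tN)//.
  by have := ntn; rewrite -[n.*2.+2]addn2 natrD => /andP[].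
rewrite (le_trans (energy_fin_le t1 ntn))//.
have Kn : (K <= n)%N by rewrite (leq_trans _ Nn)// leq_maxl.
have Ln : (L <= n)%N by rewrite (leq_trans _ Nn)// leq_maxr.
have -> : e%:E = ((e `^ r)%:E `^ r^-1)%E.
  by rewrite poweR_EFin -powRrM divff ?powRr1 ?gt_eqF// ltW.
apply: gt0_ler_poweR; rewrite ?in_itv/= ?leey ?andbT ?invr_ge0 ?(ltW r0)//.
- exact: integral_ge0.
- by rewrite lee_fin ltW.
rewrite -[leLHS]fineK; last exact: KP.
rewrite lee_fin; have := LP n Ln; rewrite /= sub0r normrN.
by apply: le_trans; exact: ler_norm.
Unshelve. all: by end_near. Qed.

End FiniteDecay.

(** * Square waves *)

Section Periodic.
Context {R : realType}.
Notation mu := (@lebesgue_measure R).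

Let q (s : R) : R := (Num.truncn ((s + 1) / 2))%:R.

Let measurable_q : measurable_fun setT q.
Proof.
apply: nondecreasing_measurable => // s t st.
by rewrite ler_nat le_truncn// ler_wpM2r// lerD2r.
Qed.

Let qS s : -1 <= s -> q (s + 2) = q s + 1.
Proof.
move=> s1; rewrite /q natr1; congr _%:R; apply: truncn_def.
have /truncn_itv/andP[] : 0 <= (s + 1) / 2 by rewrite divr_ge0// -lerBlDr sub0r.
set k := Num.truncn _ => k1 k2.
have -> : k.+2%:R = k.+1%:R + 1 :> R by rewrite natr1.
move: k2; have -> : k.+1%:R = k%:R + 1 :> R by rewrite natr1.
by move=> k2; apply/andP; split; lra.
Qed.

Let q0 s : -1 <= s < 1 -> q s = 0.
Proof.
move=> /andP[s0 s1]; rewrite /q; have -> // : Num.truncn ((s + 1) / 2) = 0%N.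
apply: truncn_def; rewrite mulr0n mulr1n.
by apply/andP; split; lra.
Qed.

Let cos_natpi (n : nat) : cos (pi * n%:R : R) = (-1) ^+ n.
Proof.
elim: n => [|n IH]; first by rewrite mulr0 cos0 expr0.
by rewrite -natr1 mulrDr mulr1 cosDpi IH exprS mulN1r.
Qed.

Context (a b : R) (ab : `|a| = `|b|).

(** q s is the number n of the interval [2 n - 1, 2 n + 1[ containing s, and
    cos (pi n) = (-1)^n.  Written this way, the alternation between a and b is
    measurable as a continuous function of a monotone one. *)
Definition square_wave (s : R) : R := (a + b) / 2 + (a - b) / 2 * cos (pi * q s).

Lemma square_wave_cases s : (square_wave s = a /\ cos (pi * q s) = 1) \/
  (square_wave s = b /\ cos (pi * q s) = -1).
Proof.
rewrite /square_wave cos_natpi -signr_odd; case: odd; rewrite ?expr0 ?expr1.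
  by right; split => //; lra.
by left; split => //; lra.
Qed.

Lemma square_wave_norm s : `|square_wave s| = `|a|.
Proof. by case: (square_wave_cases s) => -[-> _]. Qed.

Lemma measurable_square_wave : measurable_fun setT square_wave.
Proof.
apply: measurable_funD => //; apply: measurable_funM => //.
apply: (measurableT_comp (f := @cos R)).
  by apply: continuous_measurable_fun; exact: continuous_cos.
exact: measurable_funM.
Qed.

Lemma square_wave_start s : -1 <= s < 1 -> square_wave s = a.
Proof. by move=> s1; rewrite /square_wave q0// mulr0 cos0; lra. Qed.

Lemma square_wave_step (S : R -> set R) s : S a b -> S b a -> -1 <= s ->
  S (square_wave s) (square_wave (s + 2)).
Proof.
move=> Sab Sba s1.
have -> : square_wave (s + 2) = (a + b) / 2 - (a - b) / 2 * cos (pi * q s).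
  by rewrite /square_wave qS// mulrDr mulr1 cosDpi mulrN.
case: (square_wave_cases s) => -[-> ->].
  by have -> : (a + b) / 2 - (a - b) / 2 * 1 = b by lra.
by have -> : (a + b) / 2 - (a - b) / 2 * - 1 = a by lra.
Qed.

Context (p : \bar R) (p1 : (1 <= p)%E).

Let g := square_wave.
Let f s := - square_wave s.

Let Lg c : Lploc p c g.
Proof.
apply: (@bounded_Lploc _ _ _ _ `|a|) => //; first exact: measurable_square_wave.
by move=> s; rewrite square_wave_norm.
Qed.

Let Lf c : Lploc p c f.
Proof.
apply: (@bounded_Lploc _ _ _ _ `|a|) => //.
  by apply: measurableT_comp => //; exact: measurable_square_wave.
by move=> s; rewrite normrN square_wave_norm.
Qed.

(** On the initial window g = a and f = - a, so the initial position is linear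
    and the initial velocity is 0. *)
Definition square_z0 (x : R) : R := - (Num.sqrt 2 * a) * x.

Definition square_z (t x : R) : R :=
  (Num.sqrt 2)^-1 * oint 0 (t + x) f + (Num.sqrt 2)^-1 * oint 0 (t - x) g.

Let Rintegral_const (h : R -> R) (c d k : R) : c <= d ->
  (forall x, c < x < d -> h x = k) -> measurable_fun setT h ->
  \int[mu]_(x in `[c, d]) h x = k * (d - c).
Proof.
move=> cd hk mh; rewrite Rintegral_itv_oo; last exact: measurable_funTS.
rewrite (@eq_Rintegral _ _ _ mu _ (cst k)); last first.
  by move=> x; rewrite inE/= in_itv/= => /hk.
rewrite Rintegral_cst//= lebesgue_measure_itv/= lte_fin.
by move: cd; rewrite le_eqVlt => /predU1P[->|->]//=; rewrite ltxx subrr mulr0.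
Qed.

Lemma square_z0_Xp : Xp p square_z0 (cst 0).
Proof.
have LC (k : R) : Lp p `]0, 1[ (cst k).
  apply: (@bounded_Lp _ _ _ _ `|k|) => //.
  by rewrite lebesgue_measure_itv/= lte_fin ltr01 -EFinB ltry.
split=> //; split.
- apply: (@bounded_Lp _ _ _ _ `|Num.sqrt 2 * a|) => //.
  + by rewrite lebesgue_measure_itv/= lte_fin ltr01 -EFinB ltry.
  + by apply: measurable_funTS; exact: measurable_funM.
  + move=> x; rewrite /= in_itv/= => /andP[x0 x1].
    by rewrite /square_z0 normrM normrN ler_piMr// ger0_norm ltW.
- exists (cst (- (Num.sqrt 2 * a))) => //.
  apply: (@weak_derivative_primitive _ _ _ 0).
    apply: continuous_compact_integrable; first exact: segment_compact.
    by apply: continuous_subspaceT => x; exact: cst_continuous.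
  move=> x /andP[x0 x1].
  by rewrite (Rintegral_const (k := - (Num.sqrt 2 * a))) ?(ltW x0)// subr0 add0r.
- exists square_z0; split; last by rewrite /square_z0 mulr0.
  + apply: continuous_subspaceT => x; apply: cvgM; [exact: cvg_cst|exact: cvg_id].
  + exact: aeW.
Qed.

Lemma square_solution (Sigma : set (R * R)) (S : R -> set R) :
  svgraph S = rotR @` Sigma -> S a b -> S b a ->
  wave_solution_with p Sigma square_z0 (cst 0) square_z f g.
Proof.
move=> gS Sab Sba; split=> //.
- apply: aeW => t t0; split.
    rewrite /square_z addr0 subr0 /oint t0 -mulrDr.
    have gi : mu.-integrable `[0, t] (EFin \o g) by exact: Lploc_integrable (Lg 0).
    have -> : \int[mu]_(s in `[0, t]) f s = - \int[mu]_(s in `[0, t]) g s.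
      rewrite -mulN1r -RintegralZl//; apply: eq_Rintegral => s _.
      by rewrite mulN1r.
    by rewrite addNr mulr0.
  have : svgraph S (g (t - 1), g (t + 1)).
    have -> : t + 1 = t - 1 + 2 by ring.
    by apply: square_wave_step => //; lra.
  rewrite gS => -[xi Sxi e].
  suff -> : (wave_t f g t 1, - wave_x f g t 1) = xi by [].
  by apply: rotR_inj; rewrite rotR_traces e opprK.
- have n1 : {ae mu, forall x : R, x != 1}.
    exists [set 1]; split => //; first exact: lebesgue_measure_set1.
    by move=> x /= /negP; rewrite negbK => /eqP.
  move: n1; apply: (@filterS _ _ (ae_filter_ringOfSetsType mu)) => x x1 /andP[x0 x1'].
  have {x1'}x1 : x < 1 by rewrite lt_neqAle x1.
  have e2 : 0 < Num.sqrt 2 :> R by rewrite sqrtr_gt0.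
  split; last first.
    rewrite /wave_t /f /g !square_wave_start ?add0r; [|lra|lra].
    by rewrite addNr mul0r.
  rewrite /square_z add0r /oint x0.
  rewrite (Rintegral_const (k := - a))//; last 2 first.
  - by move=> s sx; rewrite /f square_wave_start//; lra.
  - by apply: measurableT_comp => //; exact: measurable_square_wave.
  have -> : (if 0 <= 0 - x then \int[mu]_(s in `[0, (0 - x)]) g s
       else - \int[mu]_(s in `[(0 - x), 0]) g s) = - (a * x).
    rewrite sub0r oppr_ge0; case: ifPn => [x0'|x0'].
      have -> : x = 0 by apply/eqP; rewrite eq_le x0 x0'.
      by rewrite oppr0 set_itv1 Rintegral_set1 mulr0 oppr0.
    rewrite (Rintegral_const (k := a)).
    - by rewrite sub0r opprK.
    - by rewrite oppr_le0.
    - by move=> s sx; rewrite /g square_wave_start//; lra.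
    - exact: measurable_square_wave.
  have -> : (Num.sqrt 2)^-1 = Num.sqrt 2 / 2 :> R.
    apply: (mulfI sqrt2_neq0); rewrite divff ?sqrt2_neq0//.
    by rewrite mulrA -expr2 sqr_sqrtr// divff.
  by rewrite /square_z0 subr0; field.
Qed.

Lemma square_energy (Sigma : set (R * R)) (S : R -> set R) (t : R) :
  svgraph S = rotR @` Sigma -> S a b -> S b a -> a != 0 -> 1 <= t ->
  ((`|a| / 2)%:E < energy p square_z f g t)%E.
Proof.
move=> gS Sab Sba a0 t1; have sol := square_solution gS Sab Sba.
have na : 0 < `|a| by rewrite normr_gt0.
rewrite ltNge; apply/negP => le.
have mu01 : mu `]0, 1[%classic = 1%E.
  by rewrite lebesgue_measure_itv/= lte_fin ltr01 -EFinB subr0.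
case: p p1 sol le => [r| |//] r1 sol le; last first.
  have [N [mN N0 nN]] := energy_oo_ae r1 sol t1 le.
  have : (mu `]0%R, 1%R[%classic <= mu N)%E.
    apply: le_measure; rewrite ?inE// => x; rewrite /= in_itv/= => x01.
    apply: nN => /= /(_ x01); rewrite normrN square_wave_norm; lra.
  by rewrite mu01 N0 leNgt lte01.
have r0 : 0 < r by rewrite (lt_le_trans ltr01)// -lee_fin.
move: le; rewrite (energy_fin r1 sol t1).
under eq_integral do rewrite normrN !square_wave_norm.
rewrite integral_cst//= mu01 mule1 poweR_EFin lee_fin leNgt => /negP; apply.
apply: (@lt_le_trans _ _ `|a|); first by lra.
have {1}-> : `|a| = (`|a| `^ r) `^ r^-1.
  by rewrite -powRrM divff ?powRr1 ?gt_eqF.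
apply: ge0_ler_powR; rewrite ?nnegrE ?addr_ge0 ?invr_ge0 ?powR_ge0 ?(ltW r0)//.
by rewrite lerDl powR_ge0.
Qed.

Lemma square_not_stable (Sigma : set (R * R)) (S : R -> set R) :
  svgraph S = rotR @` Sigma -> S a b -> S b a -> a != 0 ->
  ~ strongly_stable p Sigma.
Proof.
move=> gS Sab Sba a0 st.
have := st _ _ square_z0_Xp _ _ _ (square_solution gS Sab Sba).
have na : 0 < `|a| / 2 by rewrite divr_gt0// normr_gt0.
move=> /fine_cvgP[fin /cvgrPdist_le /(_ _ na) le].
near (pinfty_nbhs R) => t.
have t1 : 1 <= t by near: t; apply: nbhs_pinfty_ge; exact: num_real.
have := square_energy gS Sab Sba a0 t1.
rewrite ltNge => /negP; apply.
rewrite -[leLHS]fineK; last by near: t.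
rewrite lee_fin; have : `|0 - fine (energy p square_z f g t)| <= `|a| / 2 by near: t.
by rewrite sub0r normrN; apply: le_trans; exact: ler_norm.
Unshelve. all: by end_near. Qed.

End Periodic.

(** * Strict damping and stability *)

Section Main.
Context {R : realType} (Sigma : set (R * R)) (S : R -> set R) (p : \bar R)
  (dS : damping_set Sigma) (gS : svgraph S = rotR @` Sigma) (p1 : (1 <= p)%E).

Lemma strict_stable : closed (svgraph (svcomp S S)) ->
  strict_damping (svcomp S S) -> strongly_stable p Sigma.
Proof.
move=> clSS /strict_dampingP[_ _ ltSS] z0 z1 _ z f g sol.
have leS := damping_le dS gS.
apply: cvge0_le => [t|e e0]; first exact: Xnorm_ge0.
case: p p1 sol => [r| |//] r1 sol.
- exact: energy_fin_decay sol clSS leS ltSS _ e0.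
- exact: energy_oo_decay sol clSS leS ltSS _ _ e0.
Qed.

(** If |z| = |x| then |y| = |x| for the intermediate y, so y and z are x or - x.
    Either S fixes x or y, or it exchanges them. *)
Lemma isometric_cycle (x z : R) : svcomp S S x z -> (x, z) <> (0, 0) -> `|x| <= `|z| ->
  exists a b, [/\ S a b, S b a, `|a| = `|b| & a != 0].
Proof.
have leS := damping_le dS gS.
move=> [y Sxy Syz] xz0 xz.
have xy : `|y| = `|x|.
  by apply/eqP; rewrite eq_le (leS _ _ Sxy) (le_trans xz)// leS.
have zx : `|z| = `|x|.
  by apply/eqP; rewrite eq_le xz andbT -xy leS.
have x0 : x != 0.
  apply/eqP => x0; apply: xz0; move: zx; rewrite x0 normr0 => /normr0_eq0 ->.
  by [].
move: (xy) => /eqP; rewrite eqr_norm2 => /orP[] /eqP yE.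
  by exists x, x; rewrite yE in Sxy; split.
move: zx => /eqP; rewrite eqr_norm2 => /orP[] /eqP zE.
  by exists x, y; rewrite zE in Syz; split.
have zy : z = y by rewrite zE yE.
by exists y, y; rewrite zy in Syz; split => //; rewrite yE oppr_eq0.
Qed.

Lemma stable_strict : strongly_stable p Sigma -> strict_damping (svcomp S S).
Proof.
move=> st; apply/strict_dampingP; split.
- by exists 0; exact: damping00 dS gS.
- have [_ _ [phi [um lg Sphi]]] := dS.
  exists (phi \o phi); split.
  + exact: univ_measurable_comp.
  + exact: linear_growth_comp.
  + move=> x; exists (phi x).
      by suff : svgraph S (x, phi x) by []; rewrite gS.
    by suff : svgraph S (phi x, phi (phi x)) by []; rewrite gS.
- move=> x z Sxz xz0; rewrite ltNge; apply/negP => xz.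
  have [a [b [Sab Sba ab a0]]] := isometric_cycle Sxz xz0 xz.
  exact: (square_not_stable ab p1 gS Sab Sba a0).
Qed.
End Main.

Theorem corollary44 (R : realType) (Sigma : set (R * R)) (S : R -> set R)
    (p : \bar R) :
  damping_set Sigma ->
  svgraph S = rotR @` Sigma ->
  (1%:E <= p)%E ->
  closed (svgraph (svcomp S S)) ->
  strongly_stable p Sigma <-> strict_damping (svcomp S S).
Proof.
move=> dS gS p1 clSS; split; first exact: stable_strict.
exact: strict_stable.
Qed.
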